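(* Let $z>y\ge1$ be integers and $0\le\alpha<1$ be such that the $(\alpha,z,y)$-Johnson Coverage$^*$ problem is NP-hard. Then for every constant $\varepsilon>0$ there is a constant $\rho>0$ such that, given as input a point-set $\mathcal{P}\subset\{0,1\}^d$ of size $n$ (with $d=O(\log n)$) and a parameter $k$, it is NP-hard to distinguish between the following two cases: - Completeness: there exist $\mathcal{C}'=\{c_1,\dots,c_k\}\subseteq\{0,1\}^d$ and $\sigma:\mathcal{P}\to\mathcal{C}'$ such that $\sum_{a\in\mathcal{P}}\|a-\sigma(a)\|_0^2\le\rho\, n(\log n)^2$. - Soundness: for every $\mathcal{C}'=\{c_1,\dots,c_k\}\subseteq\{0,1\}^d$ and every $\sigma:\mathcal{P}\to\mathcal{C}'$, $\sum_{a\in\mathcal{P}}\|a-\sigma(a)\|_0^2\ge\left(1+\frac{(1-\alpha)(2(z-y)+1)}{(z-y)^2}-\varepsilon\right)\cdot\rho\, n(\log n)^2$.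
   Context: $\|a-b\|_0$ denotes the number of coordinates on which $a$ and $b$ differ. $(\alpha,z,y)$-Johnson Coverage problem ($z>y\ge1$): given a universe $U=[n]=\{1,\dots,n\}$, a collection $E\subseteq\binom{[n]}{z}$ of $z$-element subsets, and a parameter $k$, distinguish between: (Completeness) there are $S_1,\dots,S_k\in\binom{[n]}{y}$ such that every $T\in E$ contains some $S_i$; (Soundness) for all $S_1,\dots,S_k\in\binom{[n]}{y}$, the number of $T\in E$ containing at least one $S_i$ is at most $\alpha|E|$. The $(\alpha,z,y)$-Johnson Coverage$^*$ problem is its special case restricted to instances satisfying $|E|=\omega(k\cdot|U|^{z-y-1})$. *)

(* Defs.v *)
From mathcomp Require Import all_boot all_order all_algebra.
From mathcomp Require Import boolp classical_sets reals topology normedtype exp.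
From mathcomp Require Import fintype finset.

Set Implicit Arguments.
Unset Strict Implicit.
Unset Printing Implicit Defensive.

Import Order.TTheory GRing.Theory Num.Theory.
Import numFieldNormedType.Exports.

Local Open Scope ring_scope.

(* The machine model is the WHILE language over binary trees (Jones,
   "Computability and Complexity from a Programming Perspective").  Evaluating
   an expression is charged the size of every tree it produces, so that t units
   of time correspond to poly(t) Turing machine steps and conversely; in
   particular, sharing cannot produce large trees cheaply. *)
Inductive data : Type := DNil | DCons of data & data.

Fixpoint dsize (a : data) : nat :=
  if a is DCons b c then (dsize b + dsize c).+1 else 1%N.

Definition store := nat -> data.

Definition update (s : store) (i : nat) (a : data) : store :=
  fun j => if j == i then a else s j.

Inductive expr : Type :=
  | EVar of nat
  | ENil
  | ECons of expr & expr
  | EHd of expr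
  | ETl of expr.

Fixpoint eval (e : expr) (s : store) : data :=
  match e with
  | EVar i => s i
  | ENil => DNil
  | ECons e1 e2 => DCons (eval e1 s) (eval e2 s)
  | EHd e1 => if eval e1 s is DCons a _ then a else DNil
  | ETl e1 => if eval e1 s is DCons _ b then b else DNil
  end.

Fixpoint expr_cost (e : expr) (s : store) : nat :=
  (match e with
   | EVar _ | ENil => 0
   | ECons e1 e2 => expr_cost e1 s + expr_cost e2 s
   | EHd e1 | ETl e1 => expr_cost e1 s
   end + dsize (eval e s))%N.

Inductive cmd : Type :=
  | Skip
  | Assign of nat & expr
  | Seq of cmd & cmd
  | If of expr & cmd & cmd
  | While of expr & cmd.

(* [exec c s s' t]: from store [s], [c] halts in store [s'] after time [t].
   [DNil] is false, every other tree is true. *)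
Inductive exec : cmd -> store -> store -> nat -> Prop :=
  | exec_skip s : exec Skip s s 1
  | exec_assign i e s :
      exec (Assign i e) s (update s i (eval e s)) (expr_cost e s)
  | exec_seq c1 c2 s s1 s2 t1 t2 :
      exec c1 s s1 t1 -> exec c2 s1 s2 t2 ->
      exec (Seq c1 c2) s s2 (t1 + t2)
  | exec_if_true e c1 c2 s s1 t :
      eval e s <> DNil -> exec c1 s s1 t ->
      exec (If e c1 c2) s s1 (expr_cost e s + t)
  | exec_if_false e c1 c2 s s1 t :
      eval e s = DNil -> exec c2 s s1 t ->
      exec (If e c1 c2) s s1 (expr_cost e s + t)
  | exec_while_false e c s :
      eval e s = DNil -> exec (While e c) s s (expr_cost e s)
  | exec_while_true e c s s1 s2 t1 t2 :
      eval e s <> DNil -> exec c s s1 t1 -> exec (While e c) s1 s2 t2 ->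
      exec (While e c) s s2 (expr_cost e s + t1 + t2).

(* Input and output are in variable 0. *)
Definition load (a : data) : store := update (fun=> DNil) 0 a.

(* [f] is computable in polynomial time from inputs presented as [code x]. *)
Definition polytime (A : Type) (code : A -> data) (f : A -> data) : Prop :=
  exists (c : cmd) (e : nat), forall x : A, exists (s : store) (t : nat),
    [/\ exec c (load (code x)) s t, s 0%N = f x
      & (t <= dsize (code x) ^ e + e)%N].

Definition code_bool (b : bool) : data := if b then DCons DNil DNil else DNil.

Definition code_list (A : Type) (code : A -> data) (l : seq A) : data :=
  foldr (fun x => DCons (code x)) DNil l.

Definition code_bits : seq bool -> data := code_list code_bool.

(* Binary, least significant bit first. *)
Fixpoint bits_of_pos (p : BinNums.positive) : seq bool :=
  match p with
  | BinNums.xH => [:: true]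
  | BinNums.xO q => false :: bits_of_pos q
  | BinNums.xI q => true :: bits_of_pos q
  end.

Definition code_nat (n : nat) : data :=
  code_bits (if bin_of_nat n is BinNums.Npos p then bits_of_pos p else [::]).

Definition in_NP (L : seq bool -> Prop) : Prop :=
  exists (v : seq bool * seq bool -> bool) (e : nat),
    polytime (fun xw => DCons (code_bits xw.1) (code_bits xw.2))
             (fun xw => code_bool (v xw))
    /\ forall x : seq bool,
         L x <-> exists w : seq bool, (size w <= size x ^ e + e)%N /\ v (x, w).

(* [encodes I a]: the tree [a] is a representation of [I] (a relation, because
   a set may be listed in any order). *)
Record promise_problem := PromiseProblem {
  instance : Type;
  encodes : instance -> data -> Prop;
  yes_case : instance -> Prop;
  no_case : instance -> Prop }.

(* Hardness under polynomial-time many-one reductions. *)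
Definition NP_hard (Q : promise_problem) : Prop :=
  forall L : seq bool -> Prop, in_NP L ->
  exists f : seq bool -> data,
    [/\ polytime code_bits f,
        (forall x, L x ->
           exists I : instance Q, encodes I (f x) /\ yes_case I)
      & (forall x, ~ L x ->
           exists I : instance Q, encodes I (f x) /\ no_case I)].

Definition restrict_problem (Q : promise_problem) (A : instance Q -> Prop) :=
  @PromiseProblem (instance Q) (@encodes Q)
    (fun I => A I /\ yes_case I) (fun I => A I /\ no_case I).

(* The universe is {0, ..., jc_n - 1}. *)
Record jc_instance := JCInstance {
  jc_n : nat;
  jc_E : {set {set 'I_jc_n}};
  jc_k : nat }.

(* The universe is listed explicitly, so that the size of an encoding is at
   least the size of the universe. *)
Definition jc_encodes (I : jc_instance) (a : data) : Prop :=
  exists s : seq {set 'I_(jc_n I)},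
    perm_eq s (enum (jc_E I)) /\
    a = DCons (code_list code_nat (iota 0 (jc_n I)))
         (DCons (code_list (fun T : {set 'I_(jc_n I)} =>
                    code_list (fun i : 'I_(jc_n I) => code_nat i) (enum T)) s)
            (code_nat (jc_k I))).

(* With an empty collection both cases of the problem hold. *)
Definition jc_valid (z : nat) (I : jc_instance) : Prop :=
  [/\ jc_E I \subset [set T : {set 'I_(jc_n I)} | #|T| == z],
      (0 < #|jc_E I|)%N & (0 < jc_k I)%N].

Definition jc_covered (I : jc_instance) (S : 'I_(jc_k I) -> {set 'I_(jc_n I)}) :
    {set {set 'I_(jc_n I)}} :=
  [set T in jc_E I | [exists i, S i \subset T]].

Definition jc_complete (y : nat) (I : jc_instance) : Prop :=
  exists S : 'I_(jc_k I) -> {set 'I_(jc_n I)},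
    (forall i, #|S i| = y) /\
    forall T, T \in jc_E I -> exists i, S i \subset T.

Definition jc_sound (R : realType) (alpha : R) (y : nat) (I : jc_instance) :
    Prop :=
  forall S : 'I_(jc_k I) -> {set 'I_(jc_n I)},
    (forall i, #|S i| = y) ->
    #|jc_covered S|%:R <= alpha * #|jc_E I|%:R.

Definition JohnsonCoverage (R : realType) (alpha : R) (z y : nat) :
    promise_problem :=
  @PromiseProblem jc_instance jc_encodes
    (fun I => jc_valid z I /\ jc_complete y I)
    (fun I => jc_valid z I /\ jc_sound alpha y I).

Definition jc_dense (R : realType) (g : nat -> R) (z y : nat)
    (I : jc_instance) : Prop :=
  g (jc_n I) * ((jc_k I)%:R * (jc_n I)%:R ^+ (z - y - 1)) <= #|jc_E I|%:R.

(* The condition |E| = omega(k |U|^(z-y-1)) on a class of instances: for some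
   g tending to infinity, |E| >= g(|U|) k |U|^(z-y-1) throughout the class. *)
Definition JohnsonCoverageStar_NP_hard (R : realType) (alpha : R) (z y : nat) :
    Prop :=
  exists g : nat -> R, (g n @[n --> \oo] --> +oo)%classic /\
    NP_hard (@restrict_problem (JohnsonCoverage alpha z y) (jc_dense g z y)).

Record km_instance := KMInstance {
  km_d : nat;
  km_P : {set km_d.-tuple bool};
  km_k : nat }.

Definition km_encodes (I : km_instance) (a : data) : Prop :=
  exists s : seq ((km_d I).-tuple bool),
    perm_eq s (enum (km_P I)) /\
    a = DCons (code_list (fun p : (km_d I).-tuple bool => code_bits p) s)
          (code_nat (km_k I)).

Definition hamming (d : nat) (a b : d.-tuple bool) : nat :=
  #|[set i : 'I_d | tnth a i != tnth b i]|.

Definition km_cost (I : km_instance)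
    (sigma : (km_d I).-tuple bool -> (km_d I).-tuple bool) : nat :=
  (\sum_(a in km_P I) hamming a (sigma a) ^ 2)%N.

Definition km_assignment (I : km_instance)
    (c : 'I_(km_k I) -> (km_d I).-tuple bool)
    (sigma : (km_d I).-tuple bool -> (km_d I).-tuple bool) : Prop :=
  forall a, a \in km_P I -> exists i, sigma a = c i.

(* At least two points, so that log n > 0: for n = 1 both cases would hold. *)
Definition km_valid (R : realType) (D : R) (I : km_instance) : Prop :=
  [/\ (1 < #|km_P I|)%N, (0 < km_k I)%N
    & (km_d I)%:R <= D * ln (#|km_P I|%:R : R)].

Definition km_unit (R : realType) (rho : R) (I : km_instance) : R :=
  rho * #|km_P I|%:R * ln (#|km_P I|%:R : R) ^+ 2.

Definition km_complete (R : realType) (rho : R) (I : km_instance) : Prop :=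
  exists c sigma, @km_assignment I c sigma /\
    (@km_cost I sigma)%:R <= km_unit rho I.

Definition km_sound (R : realType) (rho gamma : R) (I : km_instance) : Prop :=
  forall c sigma, @km_assignment I c sigma ->
    gamma * km_unit rho I <= (@km_cost I sigma)%:R.

(* Distinguishing cost at most rho n (log n)^2 from cost at least gamma times
   that, on point sets of dimension at most D log n. *)
Definition GapKMeans (R : realType) (D rho gamma : R) : promise_problem :=
  @PromiseProblem km_instance km_encodes
    (fun I => km_valid D I /\ km_complete rho I)
    (fun I => km_valid D I /\ km_sound rho gamma I).

(* Main.v *)
(** Every element [u] of the universe gets a code word [V u] of weight [m ~ log N],
    [N = |E|], such that two code words share at most a small fraction of [m]; a greedy code
    in dimension [O(m)] can be found in polynomial time.  The point of [T] is the union of the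
    [V u], [u \in T], and a set [S] of a solution becomes the center which is the union of its
    code words, at distance [(z - y) m] from the points of the [T] containing [S].  Conversely,
    for an arbitrary center [C] call [u] heavy when [C] meets [V u] in more than [m / r] places.
    If many elements are heavy, then [C] is too large to be close to anything.  Otherwise at
    most [2^h n^(z-y-1)] sets [T] contain more than [y] heavy elements, which is [o(N / k)] by
    the density condition, and every other [T] at distance less than about [(z - y + 1) m] from
    [C] contains exactly [y] heavy elements, the same ones for all such [T].  So [k] centers
    give [k] sets of size [y], and a fraction [1 - alpha] of the points pays
    [((z - y + 1) m)^2].  The finitely many instances on few elements, where the density
    condition says nothing, are decided by a table. *)

From mathcomp Require Import all_boot all_order all_algebra.
From mathcomp Require Import boolp classical_sets reals topology normedtype sequences exp.
From mathcomp Require Import fintype finset zify lra ring.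
Require Import Defs.

Set Implicit Arguments.
Unset Strict Implicit.
Unset Printing Implicit Defensive.

Import Order.TTheory GRing.Theory Num.Theory.

(** * Polynomial-time functions on coded types *)

(** The obstacle is that centers are arbitrary points of the cube, not unions of code words. The
    only way for one center to be close to many points is to contain most of the code words of a
    common set, which is why near-disjoint code words of equal weight are used. With [w = z - y], a
    covered point pays [(w m)^2] and an uncovered one about [((w + 1) m)^2]; averaging with weights
    [alpha] and [1 - alpha] gives [w^2 + (1 - alpha)(2 w + 1)] times [m^2], which is the stated
    factor. All errors (overlaps, light elements, exceptional sets, rounding of the logarithm) are a
    fraction [d] of the main terms and are paid for by [eps].

    The code is found by exhaustive search: over an alphabet of constant size [q] there are [q^m]
    words of length [m], and [2^m <= 2 z N], so this is polynomial in [N]; the dimension [q m] is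
    [O(log N)].

    Neither [alpha] nor the growth function [g] is assumed computable. This is harmless, since they
    enter the program only through constants: the table of small instances, the size threshold and
    the code parameters. *)

Class Code (A : Type) := code : A -> data.
Arguments code {A _} : simpl never.
Arguments dsize : simpl never.
#[global] Instance code_data : Code data := fun a => a.
#[global] Instance code_boolI : Code bool := code_bool.
#[global] Instance code_seqI A (cA : Code A) : Code (seq A) := code_list cA.
Arguments code_seqI : simpl never.
#[global] Instance code_prodI A B (cA : Code A) (cB : Code B) : Code (A * B) :=
  fun x => DCons (code x.1) (code x.2).
Arguments code_prodI : simpl never.

Notation csize x := (dsize (code x)).

(** The base is at least 2, so constants and sums can be absorbed into the exponent. *)
Definition polyb (A : Type) (cA : Code A) (F : A -> nat) :=
  exists e, forall x, F x <= (csize x).+1 ^ e.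
Arguments polyb {A cA} F.

Lemma dsize_gt0 a : 0 < dsize a.
Proof. by case: a. Qed.

Lemma dsize_cons a b : dsize (DCons a b) = (dsize a + dsize b).+1.
Proof. by []. Qed.

Lemma dsize_nil : dsize DNil = 1.
Proof. by []. Qed.

Lemma csize_pair A B (cA : Code A) (cB : Code B) (x : A) (y : B) :
  csize (x, y) = (csize x + csize y).+1.
Proof. by []. Qed.

Lemma csize_cons A (cA : Code A) (x : A) (s : seq A) :
  csize (x :: s) = (csize x + csize s).+1.
Proof. by []. Qed.

Lemma code_cons A (cA : Code A) (x : A) (s : seq A) :
  code (x :: s) = DCons (code x) (code s).
Proof. by []. Qed.

Lemma code_pair A B (cA : Code A) (cB : Code B) (x : A) (y : B) :
  code (x, y) = DCons (code x) (code y).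
Proof. by []. Qed.

Lemma code_nil A (cA : Code A) : code ([::] : seq A) = DNil.
Proof. by []. Qed.

Lemma csize_nil A (cA : Code A) : csize ([::] : seq A) = 1.
Proof. by []. Qed.

Lemma csize_cat A (cA : Code A) (s1 s2 : seq A) :
  (csize (s1 ++ s2)).+1 = csize s1 + csize s2.
Proof.
elim: s1 => [|x s1 IH] //=.
by rewrite !csize_cons; move: IH; lia.
Qed.

Lemma size_csize A (cA : Code A) (s : seq A) : size s < csize s.
Proof. by elim: s => [|x s IH] //=; rewrite csize_cons ltnS (leq_trans IH) ?leq_addl. Qed.

Lemma mem_csize (A : eqType) (cA : Code A) (s : seq A) x : x \in s -> csize x < csize s.
Proof.
elim: s => [|y s IH] //; rewrite inE csize_cons => /orP[/eqP->|/IH]; lia.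
Qed.

Arguments csize_cat {A cA}.
Arguments size_csize {A cA}.
Arguments mem_csize {A cA}.

Section Polynomials.
Context (A : Type) (cA : Code A).
Implicit Types F G : A -> nat.

Lemma polyb_le F G : polyb G -> (forall x, F x <= G x) -> polyb F.
Proof. by move=> [e He] H; exists e => x; exact: leq_trans (H x) (He x). Qed.

Lemma leq_base (n e f : nat) : e <= f -> n.+1 ^ e <= n.+1 ^ f.
Proof. by move=> h; rewrite leq_pexp2l. Qed.

Lemma polyb_const c : polyb (fun _ : A => c).
Proof.
exists c => x; apply: leq_trans (_ : 2 ^ c <= _); first exact/ltnW/ltn_expl.
by case: c => // c; rewrite leq_exp2r ?ltnS ?dsize_gt0.
Qed.

Lemma polyb_size : polyb (fun x : A => csize x).
Proof. by exists 1 => x; rewrite expn1. Qed.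

Lemma polyb_add F G : polyb F -> polyb G -> polyb (fun x => F x + G x).
Proof.
move=> [e He] [f Hf]; exists (maxn e f).+1 => x.
rewrite expnS; apply: leq_trans (_ : 2 * (csize x).+1 ^ maxn e f <= _).
  rewrite mul2n -addnn leq_add //.
    by apply: leq_trans (He x) _; rewrite leq_base ?leq_maxl.
  by apply: leq_trans (Hf x) _; rewrite leq_base ?leq_maxr.
by rewrite leq_mul2r ltnS dsize_gt0 orbT.
Qed.

Lemma polyb_mul F G : polyb F -> polyb G -> polyb (fun x => F x * G x).
Proof. by move=> [e He] [f Hf]; exists (e + f) => x; rewrite expnD leq_mul. Qed.

Lemma polyb_exp F e : polyb F -> polyb (fun x => F x ^ e).
Proof.
move=> hF; elim: e => [|e IH]; first exact: polyb_const.
by apply: polyb_le (polyb_mul hF IH) _ => x; rewrite expnS.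
Qed.

Lemma polyb_comp B (cB : Code B) (f : A -> B) (F : B -> nat) :
  polyb (fun x => csize (f x)) -> polyb F -> polyb (fun x => F (f x)).
Proof.
move=> hf [e He].
apply: polyb_le (_ : polyb (fun x => (csize (f x) + 1) ^ e)) _ => [|x].
  by apply: polyb_exp; apply: polyb_add hf (polyb_const 1).
by rewrite addn1.
Qed.

End Polynomials.

(** * Timed Hoare triples and combinators for polynomial-time programs *)

Definition runs c s (Q : store -> Prop) (T : nat) :=
  exists s' t, [/\ exec c s s' t, Q s' & t <= T].

Lemma runs_le c s (Q Q' : store -> Prop) T T' :
  runs c s Q T -> (forall s', Q s' -> Q' s') -> T <= T' -> runs c s Q' T'.
Proof.
by move=> [s' [t [h1 h2 h3]]] hQ hT; exists s', t; split; [|exact: hQ|exact: leq_trans hT].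
Qed.

Lemma runs_seq c1 c2 s Q1 Q2 T1 T2 :
  runs c1 s Q1 T1 -> (forall s1, Q1 s1 -> runs c2 s1 Q2 T2) ->
  runs (Seq c1 c2) s Q2 (T1 + T2).
Proof.
move=> [s1 [t1 [h1 q1 l1]]] /(_ s1 q1) [s2 [t2 [h2 q2 l2]]].
by exists s2, (t1 + t2); split; [exact: exec_seq h1 h2| |exact: leq_add].
Qed.

Lemma runs_assign i e s (Q : store -> Prop) T :
  Q (update s i (eval e s)) -> expr_cost e s <= T -> runs (Assign i e) s Q T.
Proof. by move=> q l; exists (update s i (eval e s)), (expr_cost e s); split=> //; constructor. Qed.

Lemma runs_if i c1 c2 s Q T :
  (s i <> DNil -> runs c1 s Q T) -> (s i = DNil -> runs c2 s Q T) ->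
  runs (If (EVar i) c1 c2) s Q (dsize (s i) + T).
Proof.
move=> h1 h2; case E: (s i) => [|a b].
  have [s' [t [x q l]]] := h2 E; exists s', (expr_cost (EVar i) s + t).
  by split; [apply: exec_if_false| |rewrite /= E leq_add2l].
have ne : s i <> DNil by rewrite E.
have [s' [t [x q l]]] := h1 ne; exists s', (expr_cost (EVar i) s + t).
by split; [apply: exec_if_true| |rewrite /= E leq_add2l].
Qed.

Lemma update_eq s i a : update s i a i = a.
Proof. by rewrite /update eqxx. Qed.

Lemma update_ne s i j a : j != i -> update s i a j = s j.
Proof. by rewrite /update => /negbTE->. Qed.

(* [f] preserves the registers below its argument, so that a caller keeps its own
   values there while the scratch space of [f] lies above. *)
Definition PT (A B : Type) (cA : Code A) (cB : Code B) (f : A -> B) :=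
  polyb (fun x => csize (f x)) /\
  forall b, exists (c : cmd) (T : A -> nat), polyb T /\
    forall x s, s b = code x ->
      runs c s (fun s' => s' b = code (f x) /\ forall j, j < b -> s' j = s j) (T x).
Arguments PT {A B cA cB} f.

Section Combinators.
Context (A B C : Type) (cA : Code A) (cB : Code B) (cC : Code C).

Lemma PT_ext (f g : A -> B) : PT f -> (forall x, f x = g x) -> PT g.
Proof. by move=> h fg; have <- : f = g by apply: funext. Qed.

Lemma PT_id : PT (fun x : A => x).
Proof.
split; first exact: polyb_size.
move=> b; exists Skip, (fun=> 1); split; first exact: polyb_const.
by move=> x s h; exists s, 1; split=> //; constructor.
Qed.

Lemma PT_code : PT (fun x : A => code x).
Proof.
split; first exact: polyb_size.
move=> b; exists Skip, (fun=> 1); split; first exact: polyb_const.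
by move=> x s h; exists s, 1; split=> //; constructor.
Qed.

Lemma PT_comp (f : A -> B) (g : B -> C) : PT f -> PT g -> PT (fun x => g (f x)).
Proof.
move=> [sf hf] [sg hg]; split; first exact: polyb_comp sf sg.
move=> b; have [c1 [T1 [p1 h1]]] := hf b; have [c2 [T2 [p2 h2]]] := hg b.
exists (Seq c1 c2), (fun x => T1 x + T2 (f x)); split.
  by apply: polyb_add p1 _; apply: polyb_comp sf p2.
move=> x s hs; apply: runs_seq (h1 x s hs) _ => s1 [hs1 k1].
by apply: runs_le (h2 _ _ hs1) _ (leqnn _) => s2 [-> k2]; split=> // j hj; rewrite k2 ?k1.
Qed.

Lemma PT_pair (f : A -> B) (g : A -> C) : PT f -> PT g -> PT (fun x => (f x, g x)).
Proof.
move=> [sf hf] [sg hg].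
have sz : polyb (fun x => csize (f x, g x)).
  apply: polyb_le (polyb_add (polyb_const _ 1) (polyb_add sf sg)) _ => x.
  by rewrite csize_pair.
split=> // b; have [c1 [T1 [p1 h1]]] := hf b.+1; have [c2 [T2 [p2 h2]]] := hg b.+2.
(* Each program preserves the registers below its own, so [x] survives in [b] while [f x] is
   computed in [b.+1], and [f x] survives while [g x] is computed in [b.+2]. *)
exists (Seq (Assign b.+1 (EVar b)) (Seq c1 (Seq (Assign b.+2 (EVar b)) (Seq c2
   (Assign b (ECons (EVar b.+1) (EVar b.+2))))))).
exists (fun x => csize x + (T1 x + (csize x + (T2 x +
   (csize (f x) + csize (g x) + csize (f x, g x)))))); split.
  repeat (apply: polyb_add => //); exact: polyb_size.
move=> x s hs; apply: (@runs_seq _ _ _ (fun s' => [/\ s' b = code x, s' b.+1 = code x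
    & forall j, j < b -> s' j = s j])).
  apply: runs_assign; last by rewrite /= hs.
  split; rewrite /= ?update_eq //; first by rewrite update_ne ?hs //; lia.
  by move=> j hj; rewrite update_ne //; lia.
move=> s1 [h1b h1b1 k1].
apply: (@runs_seq _ _ _ (fun s' => [/\ s' b = code x, s' b.+1 = code (f x)
    & forall j, j < b -> s' j = s j])).
  apply: runs_le (h1 x s1 h1b1) _ (leqnn _) => s2 [h2b1 k2]; split=> //.
    by rewrite k2.
  by move=> j hj; rewrite k2 ?k1 //; lia.
move=> s2 [h2b h2b1 k2].
apply: (@runs_seq _ _ _ (fun s' => [/\ s' b.+2 = code x, s' b.+1 = code (f x)
    & forall j, j < b -> s' j = s j])).
  apply: runs_assign; last by rewrite /= h2b.
  split; rewrite /= ?update_eq //; first by rewrite update_ne //; lia.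
  by move=> j hj; rewrite update_ne ?k2 //; lia.
move=> s3 [h3b h3b1 k3].
apply: (@runs_seq _ _ _ (fun s' => [/\ s' b.+2 = code (g x), s' b.+1 = code (f x)
    & forall j, j < b -> s' j = s j])).
  apply: runs_le (h2 x s3 h3b) _ (leqnn _) => s4 [h4 k4]; split=> //.
    by rewrite k4.
  by move=> j hj; rewrite k4 ?k3 //; lia.
move=> s4 [h4b h4b1 k4].
apply: runs_assign; last by rewrite /= h4b h4b1.
rewrite /= h4b h4b1 update_eq; split=> // j hj; rewrite update_ne ?k4 //; lia.
Qed.

End Combinators.

Section Structural.
Context (A B : Type) (cA : Code A) (cB : Code B).

Lemma PT_expr (f : A -> B) (e : nat -> expr) :
  polyb (fun x => csize (f x)) ->
  (forall b (x : A) s, s b = code x -> eval (e b) s = code (f x)) ->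
  (exists k, forall b (x : A) s, s b = code x -> expr_cost (e b) s <= k * csize x + k) ->
  PT f.
Proof.
move=> sf hf [k hk]; split=> // b.
exists (Assign b (e b)), (fun x => k * csize x + k); split.
  by apply: polyb_add (polyb_mul (polyb_const _ k) (polyb_size _)) (polyb_const _ k).
move=> x s hs; apply: runs_assign; last exact: hk.
by rewrite update_eq (hf b x s hs); split=> // j hj; rewrite update_ne //; lia.
Qed.

End Structural.

Lemma PT_fst A B (cA : Code A) (cB : Code B) : PT (fun x : A * B => x.1).
Proof.
apply: (PT_expr (e := fun b => EHd (EVar b))) => [|b x s /= ->//|].
  by apply: polyb_le (polyb_size _) _ => -[x y]; rewrite csize_pair /=; lia.
exists 2 => b [x y] s /= ->; rewrite csize_pair /=; lia.
Qed.

Lemma PT_snd A B (cA : Code A) (cB : Code B) : PT (fun x : A * B => x.2).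
Proof.
apply: (PT_expr (e := fun b => ETl (EVar b))) => [|b x s /= ->//|].
  by apply: polyb_le (polyb_size _) _ => -[x y]; rewrite csize_pair /=; lia.
exists 2 => b [x y] s /= ->; rewrite csize_pair /=; lia.
Qed.

Lemma PT_nil A B (cA : Code A) (cB : Code B) : PT (fun _ : A => [::] : seq B).
Proof.
apply: (PT_expr (e := fun b => ENil)) => [|//|]; first exact: polyb_const.
by exists 1 => b x s _; exact: leq_addl.
Qed.

(** A program sees only trees: functions into different types whose results have equal codes share
    one program, e.g. pairing and [cons]. *)
Lemma PT_recode A B C (cA : Code A) (cB : Code B) (cC : Code C) (f : A -> B) (g : A -> C) :
  PT f -> (forall x, code (f x) = code (g x)) -> PT g.
Proof.
move=> [sf hf] fg; split; first by apply: polyb_le sf _ => x; rewrite fg.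
move=> b; have [c [T [p h]]] := hf b; exists c, T; split=> // x s hs.
by rewrite -fg; exact: h.
Qed.

Lemma PT_cons A B (cA : Code A) (cB : Code B) (f : A -> B) (g : A -> seq B) :
  PT f -> PT g -> PT (fun x => f x :: g x).
Proof. by move=> hf hg; apply: (PT_recode (PT_pair hf hg)). Qed.

Lemma PT_behead A B (cA : Code A) (cB : Code B) (f : A -> seq B) :
  PT f -> PT (fun x => behead (f x)).
Proof.
move=> hf; apply: (PT_comp (g := fun s : seq B => behead s)) hf _.
apply: (PT_expr (e := fun b => ETl (EVar b))).
- by apply: polyb_le (polyb_size _) _ => -[|x s] //; rewrite csize_cons /=; lia.
- by move=> b [|x l] s /= ->.
exists 2 => b [|x l] s /= ->; rewrite ?csize_cons /= ?csize_nil ?dsize_nil // -[code_seqI cB l]/(code l); lia.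
Qed.

Lemma PT_if A B (cA : Code A) (cB : Code B) (p : A -> bool) (f g : A -> B) :
  PT p -> PT f -> PT g -> PT (fun x => if p x then f x else g x).
Proof.
move=> [sp hp] [sf hf] [sg hg]; split.
  by apply: polyb_le (polyb_add sf sg) _ => x; case: (p x); lia.
move=> b; have [c0 [T0 [p0 h0]]] := hp b.+1.
have [c1 [T1 [p1 h1]]] := hf b; have [c2 [T2 [p2 h2]]] := hg b.
exists (Seq (Assign b.+1 (EVar b)) (Seq c0 (If (EVar b.+1) c1 c2))).
exists (fun x => csize x + (T0 x + (csize (p x) + (T1 x + T2 x)))); split.
  repeat (apply: polyb_add => //); exact: polyb_size.
move=> x s hs; apply: (@runs_seq _ _ _ (fun s' => [/\ s' b = code x, s' b.+1 = code x
    & forall j, j < b -> s' j = s j])).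
  apply: runs_assign; last by rewrite /= hs.
  split; rewrite /= ?update_eq //; first by rewrite update_ne ?hs //; lia.
  by move=> j hj; rewrite update_ne //; lia.
move=> s1 [h1b h1b1 k1].
apply: (@runs_seq _ _ _ (fun s' => [/\ s' b = code x, s' b.+1 = code (p x)
    & forall j, j < b -> s' j = s j])).
  apply: runs_le (h0 x s1 h1b1) _ (leqnn _) => s2 [h2b1 k2]; split=> //.
    by rewrite k2.
  by move=> j hj; rewrite k2 ?k1 //; lia.
move=> s2 [h2b h2b1 k2]; rewrite -h2b1; apply: runs_if => e.
  have -> : p x = true by move: e; rewrite h2b1; case: (p x).
  apply: runs_le (h1 x s2 h2b) _ (leq_addr _ _) => s3 [-> k3].
  by split=> // j hj; rewrite k3 ?k2.
have -> : p x = false by move: e; rewrite h2b1; case: (p x).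
apply: runs_le (h2 x s2 h2b) _ (leq_addl _ _) => s3 [-> k3].
by split=> // j hj; rewrite k3 ?k2.
Qed.

Lemma PT_true A (cA : Code A) : PT (fun _ : A => true).
Proof.
apply: (PT_expr (e := fun b => ECons ENil ENil)) => [|//|]; first exact: polyb_const.
by exists 5 => b x s _; exact: leq_addl.
Qed.

Lemma PT_false A (cA : Code A) : PT (fun _ : A => false).
Proof.
apply: (PT_expr (e := fun b => ENil)) => [|//|]; first exact: polyb_const.
by exists 1 => b x s _; exact: leq_addl.
Qed.

Lemma PT_uncons A B C (cA : Code A) (cB : Code B) (cC : Code C)
    (l : A -> seq B) (f : A -> C) (g : A * (B * seq B) -> C) :
  PT l -> PT f -> PT g ->
  PT (fun x => if l x is h :: t then g (x, (h, t)) else f x).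
Proof.
move=> [sl hl] [sf hf] [sg hg].
(* Head and tail are no larger than [l x], so a bound polynomial in the argument of [g] is also
   polynomial in [x]. *)
have hT : forall F : A * (B * seq B) -> nat, polyb F -> exists2 G : A -> nat, polyb G &
    forall x h t, l x = h :: t -> F (x, (h, t)) <= G x.
  move=> F [e He]; exists (fun x => (csize x + csize (l x) + 2) ^ e).
    apply: polyb_exp; apply: polyb_add (polyb_const _ 2).
    exact: polyb_add (polyb_size _) sl.
  move=> x h t E; apply: leq_trans (He _) _; case: e {He} => // e.
  by rewrite leq_exp2r // !csize_pair E csize_cons; lia.
split.
  have [G pG hG] := hT _ sg; apply: polyb_le (polyb_add sf pG) _ => x.
  by case E: (l x) => [|h t]; [|apply: leq_trans (hG _ _ _ E) _]; lia.
move=> b; have [c0 [T0 [p0 h0]]] := hl b.+1.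
have [c1 [T1 [p1 h1]]] := hf b; have [c2 [T2 [p2 h2]]] := hg b.
have [T3 p3 h3] := hT _ p2.
exists (Seq (Assign b.+1 (EVar b)) (Seq c0 (If (EVar b.+1)
   (Seq (Assign b (ECons (EVar b) (EVar b.+1))) c2) c1))).
exists (fun x => csize x + (T0 x + (csize (l x) + (csize x + csize (l x) +
   (csize x + csize (l x) + 1) + T3 x + T1 x)))); split.
  repeat (apply: polyb_add => //); try exact: polyb_size; exact: polyb_const.
move=> x s hs; apply: (@runs_seq _ _ _ (fun s' => [/\ s' b = code x, s' b.+1 = code x
    & forall j, j < b -> s' j = s j])).
  apply: runs_assign; last by rewrite /= hs.
  split; rewrite /= ?update_eq //; first by rewrite update_ne ?hs //; lia.
  by move=> j hj; rewrite update_ne //; lia.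
move=> s1 [h1b h1b1 k1].
apply: (@runs_seq _ _ _ (fun s' => [/\ s' b = code x, s' b.+1 = code (l x)
    & forall j, j < b -> s' j = s j])).
  apply: runs_le (h0 x s1 h1b1) _ (leqnn _) => s2 [h2b1 k2]; split=> //.
    by rewrite k2.
  by move=> j hj; rewrite k2 ?k1 //; lia.
move=> s2 [h2b h2b1 k2]; rewrite -{1}h2b1; apply: runs_if => e; last first.
  have -> : l x = [::] by move: e; rewrite h2b1; case: (l x).
  apply: runs_le (h1 x s2 h2b) _ _ => [s3 [-> k3]|]; last by lia.
  by split=> // j hj; rewrite k3 ?k2.
case E: (l x) => [|h t]; first by case: e; rewrite h2b1 E.
apply: (@runs_le _ _ (fun s' => s' b = code (g (x, (h, t))) /\
  forall j, j < b -> s' j = s j) _ (csize x + csize (l x) + (csize x + csize (l x) + 1) + T2 (x, (h, t))));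
  last 1 first.
- by rewrite -E; have := h3 _ _ _ E; lia.
- apply: (@runs_seq _ _ _ (fun s' => s' b = code (x, (h, t)) /\
    forall j, j < b -> s' j = s j)).
    apply: runs_assign; last by rewrite /= h2b h2b1 dsize_cons E; lia.
    rewrite /= update_eq h2b h2b1 E; split=> // j hj; rewrite update_ne ?k2 //; lia.
  move=> s3 [h3b k3].
  by apply: runs_le (h2 _ s3 h3b) _ (leqnn _) => s4 [-> k4]; split=> // j hj; rewrite k4 ?k3.
by [].
Qed.

Section Foldl.
Context (A V E : Type) (cA : Code A) (cV : Code V) (cE : Code E).
Variables (step : A * (V * E) -> V) (i : A -> V) (l : A -> seq E).
Let F x := foldl (fun acc h => step (x, (acc, h))) (i x).

Lemma PT_foldl (G : A -> nat) : PT step -> PT i -> PT l -> polyb G ->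
  (forall x l1 l2, l x = l1 ++ l2 -> csize (F x l1) <= G x) ->
  PT (fun x => foldl (fun acc h => step (x, (acc, h))) (i x) (l x)).
Proof.
move=> [ss hs] [si hi] [sl hl] pG hG.
have szF : polyb (fun x => csize (F x (l x))).
  by apply: polyb_le pG _ => x; apply: (hG x _ [::]); rewrite cats0.
split=> // b; have [ci [Ti [pi_ hi_]]] := hi b.+1; have [cl [Tl [pl_ hl_]]] := hl b.+2.
have [cs [Ts [[e He] hs_]]] := hs b.+3.
(* Registers: [b] holds [x], [b.+1] the accumulator, [b.+2] the remaining list, [b.+3] the argument
   and result of the step. *)
pose body := Seq (Assign b.+3 (ECons (EVar b) (ECons (EVar b.+1) (EHd (EVar b.+2)))))
  (Seq cs (Seq (Assign b.+1 (EVar b.+3)) (Assign b.+2 (ETl (EVar b.+2))))).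
exists (Seq (Assign b.+1 (EVar b)) (Seq ci (Seq (Assign b.+2 (EVar b)) (Seq cl
  (Seq (While (EVar b.+2) body) (Assign b (EVar b.+1))))))).
(* [M] bounds the step argument, including the successor in [polyb]; [K] bounds one round: [M ^ e]
   for the step, the rest for the assignments and the loop test. *)
pose M (x : A) := dsize (@code _ cA x) + G x + dsize (@code _ (code_seqI cE) (l x)) + 2.
pose K (x : A) := 12 * M x + M x ^ e.
exists (fun x => csize x + (Ti x + (csize x + (Tl x + (csize (l x) * K x + csize (F x (l x))))))).
have pM : polyb M.
  by do 2?apply: polyb_add; rewrite //; [apply: polyb_add; first exact: polyb_size|exact: polyb_const].
split.
  do 4!(apply: polyb_add => //; try exact: polyb_size).
  apply: polyb_add => //; apply: polyb_mul => //.
  by apply: polyb_add; [apply: polyb_mul => //; exact: polyb_const|exact: polyb_exp].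
move=> x s hsb; apply: (@runs_seq _ _ _ (fun s' => [/\ s' b = code x, s' b.+1 = code x
    & forall j, j < b -> s' j = s j])).
  apply: runs_assign; last by rewrite /= hsb.
  split; rewrite /= ?update_eq //; first by rewrite update_ne ?hsb //; lia.
  by move=> j hj; rewrite update_ne //; lia.
move=> s1 [h1b h1b1 k1].
apply: (@runs_seq _ _ _ (fun s' => [/\ s' b = code x, s' b.+1 = code (i x)
    & forall j, j < b -> s' j = s j])).
  apply: runs_le (hi_ x s1 h1b1) _ (leqnn _) => s2 [h2b1 k2]; split=> //.
    by rewrite k2.
  by move=> j hj; rewrite k2 ?k1 //; lia.
move=> s2 [h2b h2b1 k2].
pose I (l' : seq E) (acc : V) (s' : store) := [/\ s' b = @code _ cA x, s' b.+1 = @code _ cV acc,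
   s' b.+2 = @code _ (code_seqI cE) l' & forall j, j < b -> s' j = s j].
apply: (@runs_seq _ _ _ (fun s' => [/\ s' b = code x, s' b.+1 = code (i x), s' b.+2 = code x
   & forall j, j < b -> s' j = s j])).
  apply: runs_assign; last by rewrite /= h2b.
  split; rewrite /= ?update_eq //; try by rewrite update_ne ?hsb //; lia.
  by move=> j hj; rewrite update_ne ?k2 //; lia.
move=> s3 [h3b h3b1 h3b2 k3].
apply: (@runs_seq _ _ _ (I (l x) (i x))).
  apply: runs_le (hl_ x s3 h3b2) _ (leqnn _) => s4 [h4b k4].
  by split=> //; rewrite ?k4 //; move=> j hj; rewrite k4 ?k3 //; lia.
move=> s4 h4.
apply: (@runs_seq _ _ _ (I [::] (F x (l x)))); last first.
  move=> s5 [h5b h5b1 h5b2 k5]; apply: runs_assign; last by rewrite /= h5b1.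
  rewrite /= update_eq h5b1; split=> // j hj; rewrite update_ne ?k5 //; lia.
suff loop : forall l2 l1 s5, l x = l1 ++ l2 -> I l2 (F x l1) s5 ->
   runs (While (EVar b.+2) body) s5 (I [::] (F x (l x))) ((size l2).+1 * K x).
  apply: runs_le (loop (l x) [::] s4 erefl h4) _ _ => //.
  by rewrite leq_mul2r size_csize orbT.
elim=> [|h l2 IH] l1 s5 El.
  rewrite cats0 in El; rewrite -El => h5; have [h5b h5b1 h5b2 k5] := h5.
  exists s5, (expr_cost (EVar b.+2) s5); split=> //; first exact: exec_while_false.
  rewrite /expr_cost /eval h5b2 csize_nil mul1n /K /M; lia.
move=> [h5b h5b1 h5b2 k5].
have M0 := hG x _ _ El; have M1 : csize h + csize l2 + size l1 < csize (l x).
  have := @csize_cat _ cE l1 (h :: l2); have := @size_csize _ cE l1; rewrite -El csize_cons; lia.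
have El' : l x = rcons l1 h ++ l2 by rewrite cat_rcons.
have M2 := hG x _ _ El'.
have EF : F x (rcons l1 h) = step (x, (F x l1, h)) by rewrite /F -cats1 foldl_cat.
suff [s6 [t6 [ex6 I6 le6]]] : runs body s5 (I l2 (F x (rcons l1 h))) (11 * M x + M x ^ e).
  have [s7 [t7 [ex7 I7 le7]]] := IH _ _ El' I6.
  exists s7, (expr_cost (EVar b.+2) s5 + t6 + t7); split=> //.
    by apply: exec_while_true ex6 ex7; rewrite /= h5b2.
  rewrite /expr_cost /eval h5b2 mulSn leq_add // csize_cons.
  apply: leq_trans (leq_add (leqnn _) le6) _; rewrite /K /M; lia.
pose p := (x, (F x l1, h)).
apply: (@runs_le _ _ (I l2 (F x (rcons l1 h))) _ (8 * M x + (M x ^ e + (M x + 2 * M x)))) => //;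
  last by lia.
apply: (@runs_seq _ _ _ (fun s' => [/\ s' b = code x, s' b.+2 = code (h :: l2), s' b.+3 = code p
   & forall j, j < b -> s' j = s j])).
  apply: runs_assign; rewrite /expr_cost /eval h5b h5b1 h5b2; last first.
    rewrite code_cons /= !dsize_cons /M; lia.
  split; rewrite ?update_eq //; try by rewrite update_ne //; lia.
  by move=> j hj; rewrite update_ne ?k5 //; lia.
move=> s6 [h6b h6b2 h6b3 k6].
apply: (@runs_seq _ _ _ (fun s' => [/\ s' b = code x, s' b.+2 = code (h :: l2),
   s' b.+3 = code (step p) & forall j, j < b -> s' j = s j])).
  apply: runs_le (hs_ p s6 h6b3) _ _ => [s7 [h7b k7]|].
    by split=> //; rewrite ?k7 //; first (by lia); move=> j hj; rewrite k7 ?k6 //; lia.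
  apply: leq_trans (He p) _; case: (e) => // e'.
  by rewrite leq_exp2r // /p !csize_pair /M; lia.
move=> s7 [h7b h7b2 h7b3 k7].
apply: (@runs_seq _ _ _ (fun s' => [/\ s' b = code x, s' b.+2 = code (h :: l2),
   s' b.+1 = code (step p) & forall j, j < b -> s' j = s j])).
  apply: runs_assign; rewrite /expr_cost /eval h7b3; last by rewrite -EF /M; lia.
  split; rewrite ?update_eq //; try by rewrite update_ne //; lia.
  by move=> j hj; rewrite update_ne ?k7 //; lia.
move=> s8 [h8b h8b2 h8b1 k8].
apply: runs_assign; rewrite /expr_cost /eval h8b2 code_cons;
  last by rewrite dsize_cons /M; lia.
split; rewrite ?update_eq //; try (rewrite update_ne //; lia).
  by rewrite update_ne ?h8b1 ?EF //; lia.
by move=> j hj; rewrite update_ne ?k8 //; lia.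
Qed.

End Foldl.

(* Otherwise [csize_pair] would match the code of a nonempty list. *)
#[global] Opaque code code_seqI code_prodI.

(** * Polynomial-time list functions *)

Lemma PT_proj1 A B C (cA : Code A) (cB : Code B) (cC : Code C) (f : A -> B * C) :
  PT f -> PT (fun x => (f x).1).
Proof. by move=> h; apply: PT_comp h (PT_fst _ _). Qed.

Lemma PT_proj2 A B C (cA : Code A) (cB : Code B) (cC : Code C) (f : A -> B * C) :
  PT f -> PT (fun x => (f x).2).
Proof. by move=> h; apply: PT_comp h (PT_snd _ _). Qed.

Lemma csize_proj2 A B (cA : Code A) (cB : Code B) (p : A * B) : csize p.2 < csize p.
Proof. by case: p => x y; rewrite csize_pair ltnS leq_addl. Qed.

Ltac pt := cbv beta; repeat first [ assumption | simple eapply PT_id | simple eapply PT_nil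
  | simple eapply PT_true | simple eapply PT_false
  | simple eapply PT_pair | simple eapply PT_cons
  | simple eapply PT_proj1 | simple eapply PT_proj2 ].

Section Basic.
Context (A : Type) (cA : Code A).

Lemma PT_constant (B : Type) (cB : Code B) (c : B) : PT (fun _ : A => c).
Proof.
have h : PT (fun _ : A => code c); last by apply: (PT_recode h).
elim: (code c) => [|a ha b hb]; first by apply: (PT_recode (PT_false cA)).
by apply: (PT_recode (PT_pair ha hb)) => x; rewrite code_pair.
Qed.

Lemma PT_nonnil (B : Type) (cB : Code B) (l : A -> seq B) :
  PT l -> PT (fun x => ~~ nilp (l x)).
Proof.
move=> h; apply: PT_ext (PT_uncons h (PT_false _) (PT_true _)) _ => x.
by case: (l x).
Qed.

Lemma PT_and (p q : A -> bool) : PT p -> PT q -> PT (fun x => p x && q x).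
Proof. by move=> hp hq; apply: PT_ext (PT_if hp hq (PT_false _)) _. Qed.

Lemma PT_or (p q : A -> bool) : PT p -> PT q -> PT (fun x => p x || q x).
Proof. by move=> hp hq; apply: PT_ext (PT_if hp (PT_true _) hq) _. Qed.

Lemma PT_neg (p : A -> bool) : PT p -> PT (fun x => ~~ p x).
Proof.
move=> hp; apply: PT_ext (PT_if hp (PT_false _) (PT_true _)) _ => x.
by case: (p x).
Qed.

Lemma PT_drop (B : Type) (cB : Code B) n (l : A -> seq B) :
  PT l -> PT (fun x => drop n (l x)).
Proof.
move=> h; elim: n => [|n IH]; first by apply: PT_ext h _ => x; rewrite drop0.
by apply: PT_ext (PT_behead IH) _ => x; rewrite -drop1 drop_drop.
Qed.

End Basic.

Section Fold.
Context (A : Type) (cA : Code A).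
Context (V E : Type) (cV : Code V) (cE : Code E).

(** Growth by an amount independent of the accumulator adds up to a polynomial over the whole
    list. *)
Lemma PT_foldl_add (step : A -> V -> E -> V) (i : A -> V) (l : A -> seq E) (B : A * E -> nat) :
  PT (fun p : A * (V * E) => step p.1 p.2.1 p.2.2) -> PT i -> PT l -> polyb B ->
  (forall x acc h, csize (step x acc h) <= csize acc + B (x, h)) ->
  PT (fun x => foldl (step x) (i x) (l x)).
Proof.
move=> hs hi hl [e He] hB; have [si _] := hi; have [sl _] := hl.
apply: (PT_foldl (G := fun x => csize (i x) + csize (l x) * (csize x + csize (l x) + 2) ^ e)
  (step := fun p => step p.1 p.2.1 p.2.2)) => //.
  apply: polyb_add => //; apply: polyb_mul => //; apply: polyb_exp.
  by apply: polyb_add (polyb_const _ 2); apply: polyb_add (polyb_size _) sl.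
move=> x l1 l2 El.
have {El} El : csize l1 <= csize (l x).
  by rewrite El; have := @csize_cat _ cE l1 l2; have := dsize_gt0 (@code _ (code_seqI cE) l2); lia.
apply: leq_trans (_ : csize (i x) + size l1 * (csize x + csize (l x) + 2) ^ e <= _); last first.
  rewrite leq_add2l leq_mul2r; apply/orP; right.
  by apply: leq_trans El; exact: ltnW (size_csize _).
elim: l1 (i x) El => [|h l1 IH] acc El /=; first by rewrite addn0.
rewrite csize_cons in El.
apply: leq_trans (IH _ _) _; first by lia.
rewrite mulSn addnA leq_add2r; apply: leq_trans (hB _ _ _) _.
rewrite leq_add2l; apply: leq_trans (He _) _; case: (e) => // e'.
by rewrite leq_exp2r // csize_pair; lia.
Qed.

End Fold.

Section Reverse.
Context (A : Type) (cA : Code A).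
Context (B : Type) (cB : Code B).

Lemma PT_catrev (s t : A -> seq B) : PT s -> PT t -> PT (fun x => catrev (s x) (t x)).
Proof.
move=> hs ht.
have : PT (fun x => foldl (fun acc h => h :: acc) (t x) (s x)).
  apply: (PT_foldl_add (B := fun p => (csize p.2).+1)) hs _ _ => //.
  - by pt.
  - apply: polyb_le (polyb_size _) _ => p; exact: csize_proj2.
  by move=> x acc h; rewrite csize_cons /=; lia.
move=> h; apply: PT_ext h _ => x; elim: (s x) (t x) => //= a u IH v; exact: IH.
Qed.

Lemma PT_rev (s : A -> seq B) : PT s -> PT (fun x => rev (s x)).
Proof. by move=> hs; apply: PT_catrev hs (PT_nil _ _). Qed.

Lemma PT_cat (s t : A -> seq B) : PT s -> PT t -> PT (fun x => s x ++ t x).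
Proof.
move=> hs ht; apply: PT_ext (PT_catrev (PT_rev hs) ht) _ => x.
by rewrite catrevE revK.
Qed.

End Reverse.

Section Lists.
Context (A : Type) (cA : Code A).
Context (B C : Type) (cB : Code B) (cC : Code C).

Lemma PT_map (f : A -> B -> C) (s : A -> seq B) :
  PT (fun p => f p.1 p.2) -> PT s -> PT (fun x => [seq f x b | b <- s x]).
Proof.
move=> hf hs.
have : PT (fun x => foldl (fun acc b => f x b :: acc) [::] (s x)).
  apply: (PT_foldl_add (B := fun p => (csize (f p.1 p.2)).+1)) _ (PT_nil _ _) hs _ _ => //.
  - apply: PT_cons; last by pt.
    by apply: (PT_comp (f := fun p : A * (seq C * B) => (p.1, p.2.2))) hf; pt.
  - by have [sf _] := hf; apply: polyb_le (polyb_add sf (polyb_const _ 1)) _ => p; lia.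
  by move=> x acc h; rewrite csize_cons /=; lia.
move=> h; apply: PT_ext (PT_rev h) _ => x.
suff -> : forall acc, foldl (fun acc b => f x b :: acc) acc (s x) =
    rev [seq f x b | b <- s x] ++ acc by rewrite cats0 revK.
elim: (s x) => //= b u IH acc; by rewrite IH rev_cons -cats1 -catA.
Qed.

Definition zipstep (st : seq (B * C) * seq C) (b : B) : seq (B * C) * seq C :=
  if st.2 is c :: t then ((b, c) :: st.1, t) else (st.1, [::]).

Lemma PT_zip (s : A -> seq B) (t : A -> seq C) : PT s -> PT t -> PT (fun x => zip (s x) (t x)).
Proof.
move=> hs ht.
have : PT (fun x => foldl zipstep ([::], t x) (s x)).
  apply: (PT_foldl_add (B := fun p => (csize p.2).+1)) _ (PT_pair (PT_nil _ _) ht) hs _ _ => //.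
  - pose X : Type := (A * ((seq (B * C) * seq C) * B))%type; pose Y : Type := (X * (C * seq C))%type.
    have h1 : PT (fun p : X => p.2.1.1) by pt.
    have h2 : PT (fun p : X => p.2.1.2) by pt.
    have g1 : PT (fun p : Y => ((p.1.2.2, p.2.1) :: p.1.2.1.1, p.2.2)) by pt.
    by apply: PT_ext (PT_uncons h2 (PT_pair h1 (PT_nil _ _)) g1) _ => p; rewrite /zipstep; case: p.2.1.2.
  - apply: polyb_le (polyb_size _) _ => p; exact: csize_proj2.
  move=> x [o [|c r]] h; rewrite /zipstep /= !(csize_pair, csize_cons) /=; lia.
move=> h; apply: PT_ext (PT_rev (PT_comp h (PT_fst _ _))) _ => x.
suff -> : forall r o, (foldl zipstep (o, r) (s x)).1 = rev (zip (s x) r) ++ o by rewrite cats0 revK.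
elim: (s x) => [|b u IH] [|c r] o //=; rewrite {1}/zipstep /= IH //.
  by case: (u).
by rewrite rev_cons -cats1 -catA.
Qed.

Lemma PT_all (p : A -> B -> bool) (s : A -> seq B) :
  PT (fun q => p q.1 q.2) -> PT s -> PT (fun x => all (p x) (s x)).
Proof.
move=> hp hs.
have : PT (fun x => foldl (fun acc b => acc && p x b) true (s x)).
  apply: (PT_foldl_add (B := fun=> 3)) _ (PT_true _) hs (polyb_const _ _) _.
    cbv beta; apply: PT_and; first by pt.
    by apply: (PT_comp (f := fun q : A * (bool * B) => (q.1, q.2.2))) hp; pt.
  by move=> x acc b; case: (acc && _); case: acc.
move=> h; apply: PT_ext h _ => x.
suff -> : forall acc, foldl (fun acc b => acc && p x b) acc (s x) = acc && all (p x) (s x) by [].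
by elim: (s x) => [acc|b u IH acc] /=; rewrite ?andbT // IH andbA.
Qed.

Lemma PT_flatten (s : A -> seq (seq B)) : PT s -> PT (fun x => flatten (s x)).
Proof.
move=> hs.
have : PT (fun x => foldl (fun acc b => catrev b acc) [::] (s x)).
  apply: (PT_foldl_add (B := fun p => csize p.2)) _ (PT_nil _ _) hs _ _.
  - by apply: PT_catrev; pt.
  - apply: polyb_le (polyb_size _) _ => p; exact/ltnW/csize_proj2.
  move=> x acc h; rewrite catrevE; have := @csize_cat _ cB (rev h) acc.
  have -> : csize (rev h) = csize h; last by rewrite /=; lia.
  elim: h => [|a h IH] //; rewrite rev_cons -cats1 csize_cons.
  by have := @csize_cat _ cB (rev h) [:: a]; rewrite csize_cons csize_nil; lia.
move=> h; apply: PT_ext (PT_rev h) _ => x.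
suff -> : forall acc, foldl (fun acc b => catrev b acc) acc (s x) = rev (flatten (s x)) ++ acc.
  by rewrite cats0 revK.
by elim: (s x) => //= b u IH acc; rewrite IH catrevE rev_cat -catA.
Qed.

End Lists.

(** * Equality tests on trees and on bit lists *)

Fixpoint data_list (a : data) : seq data :=
  if a is DCons b c then b :: data_list c else [::].

Lemma code_data_list a : code (data_list a) = a.
Proof. by elim: a => [|b _ c IH] //=; rewrite code_cons IH. Qed.

Lemma PT_data_list : PT data_list.
Proof. by apply: (PT_recode (PT_id _)) => a; rewrite code_data_list. Qed.

(** As [c] is fixed, the comparison is unrolled along [c] into a program without recursion. *)
Lemma PT_eq_data (c : data) : PT (fun a : data => `[< a = c >]).
Proof.
elim: c => [|c1 h1 c2 h2].
  apply: PT_ext (PT_neg (PT_nonnil PT_data_list)) _ => a.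
  by case: a => [|b d] /=; apply/esym/asboolP.
have g : PT (fun p : data * (data * seq data) => `[< p.2.1 = c1 >] && `[< code p.2.2 = c2 >]).
  apply: PT_and; first by apply: PT_comp h1; pt.
  by apply: PT_comp h2; apply: PT_comp (PT_code _); pt.
apply: PT_ext (PT_uncons PT_data_list (PT_false _) g) _ => -[|b d] /=.
  by apply/esym/asboolP.
rewrite code_data_list; apply/andP/asboolP => [[/asboolP-> /asboolP->]//|[-> ->]].
by split; apply/asboolP.
Qed.

(** The second list is consumed as state while the fold runs over the first; [b (+) ~~ c] is the
    test [b == c]. *)
Definition eqstep (st : bool * seq bool) (b : bool) : bool * seq bool :=
  if st.2 is c :: t then (st.1 && (b (+) ~~ c), t) else (false, [::]).

Definition eqbits (s t : seq bool) : bool :=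
  let r := foldl eqstep (true, t) s in r.1 && nilp r.2.

Lemma eqbitsP s t : reflect (s = t) (eqbits s t).
Proof.
rewrite /eqbits; suff h : forall s f0 t,
  (foldl eqstep (f0, t) s).1 && nilp (foldl eqstep (f0, t) s).2 = f0 && (s == t).
  by rewrite /= h; apply: eqP.
elim=> [|a u IH] f0 [|b v] //=; rewrite ?andbT ?andbF // {2 3}/eqstep /= IH //=.
rewrite eqseq_cons andbA; congr (_ && _ && _).
by case: a b => -[].
Qed.

Lemma PT_eqbits A (cA : Code A) (s t : A -> seq bool) :
  PT s -> PT t -> PT (fun x => eqbits (s x) (t x)).
Proof.
move=> hs ht; rewrite /eqbits.
have h : PT (fun x => foldl eqstep (true, t x) (s x)).
  apply: (PT_foldl_add (B := fun p => 3)) _ (PT_pair (PT_true _) ht) hs (polyb_const _ _) _ => //.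
    pose X : Type := (A * ((bool * seq bool) * bool))%type; pose Y : Type := (X * (bool * seq bool))%type.
    have h1 : PT (fun p : X => p.2.1.1) by pt.
    have h2 : PT (fun p : X => p.2.1.2) by pt.
    have c1 : PT (fun p : Y => p.2.1) by pt.
    have b1 : PT (fun p : Y => p.1.2.2) by pt.
    have g1 : PT (fun p : Y => (p.1.2.1.1 && (p.1.2.2 (+) ~~ p.2.1), p.2.2)).
      apply: PT_pair; last by pt.
      apply: PT_and; first by pt.
      apply: PT_ext (PT_if b1 c1 (PT_neg c1)) _ => p.
      by case: p.1.2.2; case: p.2.1.
    by apply: PT_ext (PT_uncons h2 (PT_pair (PT_false _) (PT_nil _ _)) g1) _ => p; rewrite /eqstep; case: p.2.1.2.
  have sb (b : bool) : 0 < csize b <= 3 by case: b.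
  move=> x [o [|c r]] b; rewrite /eqstep /= !(csize_pair, csize_cons).
    by have := sb o; have := sb false; lia.
  by move: (o && _) => v; have := sb o; have := sb v; lia.
apply: PT_and; first exact: PT_comp h (PT_fst _ _).
apply: PT_ext (PT_neg (PT_nonnil (PT_comp h (PT_snd _ _)))) _ => x.
by rewrite negbK.
Qed.

(** * The reduction as a program *)

Notation word := (seq bool).

(** Keeping every second item halves, rounding down, a number given in unary as the length of a
    list. *)
Definition hstep (st : bool * seq bool) (b : bool) : bool * seq bool :=
  (~~ st.1, if st.1 then b :: st.2 else st.2).

Definition halve (l : seq bool) : seq bool := (foldl hstep (false, [::]) l).2.

(* [bitlen l] has as many items as [size l] has binary digits. *)
Definition bstep (st : seq bool * seq bool) (_ : bool) : seq bool * seq bool :=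
  if nilp st.1 then st else (halve st.1, true :: st.2).

Definition bitlen (l : seq bool) : seq bool := (foldl bstep (l, [::]) l).2.

(* Code words are words over an alphabet of [q] letters, each letter [i] being replaced by
   the [i]-th unit vector of length [q], so that all of them have the same weight. *)
Definition onehots (q : nat) : seq word :=
  [seq [seq i == j | j <- iota 0 q] | i <- iota 0 q].

Definition wstep (q : nat) (ws : seq word) (_ : bool) : seq word :=
  flatten [seq [seq o ++ w | o <- onehots q] | w <- ws].

Definition words (q : nat) (m : seq bool) : seq word := foldl (wstep q) [:: [::]] m.

(* [m] is a number in unary; each common one of [c] and [w] consumes [t] items of it. *)
Definition far (t : nat) (m : seq bool) (c w : word) : bool :=
  ~~ nilp (foldl (fun r (p : bool * bool) => if p.1 && p.2 then drop t r else r) m (zip c w)).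

Definition gstep (t : nat) (m : seq bool) (ch : seq word) (w : word) : seq word :=
  if all (fun c => far t m c w) ch then w :: ch else ch.

Definition greedy (t : nat) (m : seq bool) (ws : seq word) : seq word :=
  foldl (gstep t m) [::] ws.

(** The last matching key wins, so an element that occurs in several sets, and hence several times
    among the keys, still has one code word. *)
Definition lookup (a : seq (word * word)) (u : word) : word :=
  foldl (fun r (p : word * word) => if eqbits p.1 u then p.2 else r) [::] a.

Definition orl (r w : word) : word := [seq p.1 || p.2 | p <- zip r w].

Definition zeros (q : nat) (m : seq bool) : word := foldl (fun r _ => nseq q false ++ r) [::] m.

Definition point (a : seq (word * word)) (o : word) (T : seq word) : word :=
  foldl (fun r u => orl r (lookup a u)) o T.

(** The weight of the code words, in unary: the binary length of the number of element occurrences,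
    which makes the greedy code at least as large as the list of keys. *)
Definition unary (Es : seq (seq word)) : seq bool := bitlen [seq true | _ <- flatten Es].

Definition assoc (q t : nat) (Es : seq (seq word)) : seq (word * word) :=
  zip (flatten Es) (greedy t (unary Es) (words q (unary Es))).

Definition points (q t : nat) (Es : seq (seq word)) : seq word :=
  [seq point (assoc q t Es) (zeros q (unary Es)) T | T <- Es].

(** * Sizes and running times of the pieces of the reduction *)

Lemma csize_bits (s : seq bool) : size s < csize s <= 4 * size s + 1.
Proof.
elim: s => [|b s IH] //; rewrite csize_cons /=.
by have: 0 < csize b <= 3 by [case: b]; lia.
Qed.

Lemma csize_seq_le (A : eqType) (cA : Code A) (s : seq A) c :
  (forall x, x \in s -> csize x <= c) -> csize s <= size s * c.+1 + 1.
Proof.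
elim: s => [|x s IH] // h; rewrite csize_cons /=.
have h1 := h x (mem_head _ _); have := IH _; rewrite /= => h2.
have : csize s <= size s * c.+1 + 1 by apply: h2 => z hz; apply: h; rewrite inE hz orbT.
by move: h1; rewrite mulSn; lia.
Qed.

Lemma size_halve l : size (halve l) = (size l)./2.
Proof.
rewrite /halve; set s := (false, [::]).
suff h : forall st : bool * seq bool, size (foldl hstep st l).2 = size st.2 + (st.1 + size l)./2 by rewrite h.
elim: l {s} => [|b l IH] [[] o] //=; rewrite ?addn0 // IH /=; lia.
Qed.

Lemma size_bitlen l : l != [::] ->
  size l < 2 ^ size (bitlen l) <= 2 * size l.
Proof.
rewrite /bitlen.
(* The list [u] driving the loop is separated from the number [c] being halved: both start as [l],
   and it suffices that [u] is at least as long as [c]. *)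
suff h : forall n c m (u : seq bool), size u = n -> size c <= n -> exists j,
   [/\ size (foldl bstep (c, m) u).2 = size m + j, size c < 2 ^ j,
     c != [::] -> 2 ^ j <= 2 * size c & c == [::] -> j = 0].
  move=> ne; have [j [-> h1 h2 _]] := h _ l [::] l erefl (leqnn _).
  by rewrite add0n h1 h2.
elim=> [|n IH] c m [|b u] //= hu hc; first by case: c hc => // _; exists 0; split; rewrite ?addn0.
case: (eqVneq c [::]) => [->|ne].
  have -> : bstep ([::], m) b = ([::], m) by [].
  have [j [-> h1 h2 h3]] := IH [::] m u (congr1 predn hu) isT.
  by exists j; split=> //; exact: h3.
have -> : bstep (c, m) b = (halve c, true :: m) by rewrite /bstep /=; case: c ne hc.
have hs : 0 < size c by case: c ne {hc}.
have hc' : size (halve c) <= n by rewrite size_halve; lia.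
have [j [-> h1 h2 h3]] := IH (halve c) (true :: m) u (congr1 predn hu) hc'.
exists j.+1; rewrite size_halve in h1 h2; split=> //=; first by lia.
  by rewrite expnS; lia.
move=> _; rewrite expnS; have [e|e] := eqVneq (halve c) [::].
  by rewrite h3 ?e //; lia.
by have := h2 e; lia.
Qed.

Lemma PT_halve (A : Type) (cA : Code A) (l : A -> seq bool) : PT l -> PT (fun x => halve (l x)).
Proof.
move=> hl; apply: (PT_proj2 (f := fun x => foldl hstep (false, [::]) (l x))).
apply: (PT_foldl_add (step := fun=> hstep) (B := fun=> 20)) _ (PT_constant _ _ _) hl (polyb_const _ _) _.
  have s1 : PT (fun p : A * ((bool * seq bool) * bool) => p.2.1.1) by pt.
  rewrite /hstep; apply: PT_pair; first exact: PT_neg.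
  by apply: PT_if s1 _ _; pt.
move=> x [[] o] b; rewrite /hstep /= !(csize_pair, csize_cons).
  have : csize b <= 3 by case: b.
  have -> : csize true = 3 by []. 
  have -> : csize false = 1 by []. lia.
have -> : csize true = 3 by []. 
have -> : csize false = 1 by []. lia.
Qed.

Lemma csize_halve l : csize (halve l) <= csize l.
Proof.
rewrite /halve.
have h : forall st : bool * seq bool, (csize (foldl hstep st l).2).+1 <= csize st.2 + csize l;
  last by have := h (false, [::]); rewrite csize_nil /=; lia.
elim: l => [|b l IH] st; first by rewrite csize_nil addn1.
apply: leq_trans (IH _) _; rewrite /hstep csize_cons; case: st => [[] o] /=; rewrite ?csize_cons; lia.
Qed.

Lemma PT_bitlen (A : Type) (cA : Code A) (l : A -> seq bool) : PT l -> PT (fun x => bitlen (l x)).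
Proof.
move=> hl; apply: (PT_proj2 (f := fun x => foldl bstep (l x, [::]) (l x))).
apply: (PT_foldl_add (step := fun=> bstep) (B := fun=> 20)) _ (PT_pair hl (PT_nil _ _)) hl (polyb_const _ _) _.
  have s1 : PT (fun p : A * ((seq bool * seq bool) * bool) => p.2.1.1) by pt.
  have h : PT (fun p : A * ((seq bool * seq bool) * bool) =>
      if ~~ nilp p.2.1.1 then (halve p.2.1.1, true :: p.2.1.2) else p.2.1).
    by apply: PT_if; [exact: PT_nonnil|apply: PT_pair; [exact: PT_halve|pt]|pt].
  by apply: PT_ext h _ => p; rewrite /bstep if_neg.
move=> x [c o] b; rewrite /bstep /=; case: ifP => _; first by lia.
have := csize_halve c; rewrite !(csize_pair, csize_cons).
have -> : csize true = 3 by []. lia.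
Qed.

Lemma size_onehots q : size (onehots q) = q.
Proof. by rewrite size_map size_iota. Qed.

Lemma mem_onehots q o : o \in onehots q -> size o = q.
Proof. by case/mapP => i _ ->; rewrite size_map size_iota. Qed.

Lemma words_cat q m b : words q (rcons m b) = wstep q (words q m) b.
Proof. by rewrite /words -cats1 foldl_cat. Qed.

Lemma size_words q m : size (words q m) = q ^ size m.
Proof.
elim/last_ind: m => [|m b IH] //; rewrite words_cat size_rcons expnS -IH.
rewrite /wstep size_flatten /shape -map_comp.
elim: (words q m) => [|w s IHs] /=; first by rewrite muln0.
by rewrite IHs /= size_map size_onehots mulnS.
Qed.

Lemma mem_words q m w : w \in words q m -> size w = q * size m.
Proof.
elim/last_ind: m w => [|m b IH] w; first by rewrite inE => /eqP->; rewrite muln0.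
rewrite words_cat => /flattenP [s /mapP [v hv ->] /mapP [o ho ->]].
by rewrite size_cat (mem_onehots ho) (IH _ hv) size_rcons mulnS.
Qed.

(** Listing all words is affordable only for [m] of logarithmic length; the [polyb] hypothesis says
    exactly that. *)
Lemma PT_words (A : Type) (cA : Code A) q (m : A -> seq bool) : 0 < q ->
  PT m -> polyb (fun x => q ^ size (m x)) -> PT (fun x => words q (m x)).
Proof.
move=> q0 hm hq; have [sm _] := hm.
apply: (PT_foldl (step := fun p => wstep q p.2.1 p.2.2)
  (G := fun x => q ^ size (m x) * (4 * (q * csize (m x)) + 2) + 1)) _ (PT_constant _ _ _) hm _ _.
- apply: PT_flatten; apply: (PT_map (f := fun p w => [seq o ++ w | o <- onehots q])); last by pt.
  apply: (PT_map (f := fun p o => o ++ p.2)) _ (PT_constant _ _ _).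
  by apply: PT_cat; pt.
- apply: polyb_add (polyb_const _ _); apply: polyb_mul => //.
  apply: polyb_add (polyb_const _ _); do 2!apply: polyb_mul (polyb_const _ _) _ => //.
move=> x l1 l2 El; rewrite -/(words q l1).
have hl : size l1 <= size (m x) by rewrite El size_cat leq_addr.
have hm' : size (m x) <= csize (m x) by apply: ltnW; apply: size_csize.
apply: leq_trans (csize_seq_le (c := 4 * (q * csize (m x)) + 1) _) _.
  move=> w /mem_words hw; have /andP [_ h] := csize_bits w.
  apply: leq_trans h _; rewrite hw leq_add2r leq_mul2l leq_mul2l (leq_trans hl hm') !orbT //.
rewrite size_words leq_add2r -[_.+1]addn1 -addnA leq_mul2r; apply/orP; right.
exact: leq_pexp2l.
Qed.

Lemma PT_far (A : Type) (cA : Code A) t (m : A -> seq bool) (c w : A -> word) :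
  PT m -> PT c -> PT w -> PT (fun x => far t (m x) (c x) (w x)).
Proof.
move=> hm hc hw; apply: PT_nonnil.
apply: (PT_foldl_add (B := fun=> 0)) _ hm (PT_zip hc hw) (polyb_const _ _) _.
  by apply: PT_if; [apply: PT_and; pt|apply: PT_drop; pt|pt].
move=> x r p; case: ifP => _; last by rewrite addn0.
rewrite addn0; elim: t r => [|t IH] [|b r] //=.
by apply: leq_trans (IH _) _; rewrite csize_cons; lia.
Qed.

Lemma PT_greedy (A : Type) (cA : Code A) t (m : A -> seq bool) (ws : A -> seq word) :
  PT m -> PT ws -> PT (fun x => greedy t (m x) (ws x)).
Proof.
move=> hm hws; apply: (PT_foldl_add (B := fun p => (csize p.2).+1)) _ (PT_nil _ _) hws _ _.
- rewrite /gstep; apply: PT_if; last by pt.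
    apply: (PT_all (p := fun p c => far t (m p.1) c p.2.2)); last by pt.
    by apply: PT_far; try (by pt); apply: PT_comp hm; pt.
  by pt.
- by apply: polyb_le (polyb_size _) _ => p; exact: csize_proj2.
move=> x ch w; rewrite /gstep; case: ifP => _ /=; rewrite ?csize_cons; lia.
Qed.

Lemma PT_lookup (A : Type) (cA : Code A) (a : A -> seq (word * word)) (u : A -> word) :
  PT a -> PT u -> PT (fun x => lookup (a x) (u x)).
Proof.
move=> ha hu; apply: (PT_foldl_add (B := fun p => csize p.2)) _ (PT_nil _ _) ha _ _.
- apply: PT_if; [|by pt|by pt].
  by apply: PT_eqbits; [pt|apply: PT_comp hu; pt].
- by apply: polyb_le (polyb_size _) _ => p; exact/ltnW/csize_proj2.
move=> x r [p1 p2]; case: ifP => _ /=; rewrite ?csize_pair; lia.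
Qed.

Lemma PT_point (A : Type) (cA : Code A) (a : A -> seq (word * word)) (o : A -> word) (T : A -> seq word) :
  PT a -> PT o -> PT T -> PT (fun x => point (a x) (o x) (T x)).
Proof.
move=> ha ho hT.
have hl : PT (fun p : A * word => lookup (a p.1) p.2).
  by apply: PT_lookup; [apply: PT_comp ha; pt|pt].
have hl' : PT (fun p : A * (word * word) => lookup (a p.1) p.2.2).
  by apply: PT_lookup; [apply: PT_comp ha; pt|pt].
apply: (PT_foldl_add (B := fun p => csize (lookup (a p.1) p.2))) _ ho hT _ _.
- apply: (PT_map (f := fun p q => q.1 || q.2)); first by apply: PT_or; pt.
  by apply: PT_zip; pt.
- by case: hl.
move=> x r u /=; move: (lookup _ _) => w; rewrite /orl.
elim: r w => [|b r IH] [|c w] //; rewrite ?csize_nil //=; try by rewrite ?csize_cons; lia.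
rewrite !csize_cons; have := IH w.
have : csize (b || c) <= csize b + csize c by case: b; case: c.
by lia.
Qed.

Lemma PT_zeros (A : Type) (cA : Code A) q (m : A -> seq bool) : PT m -> PT (fun x => zeros q (m x)).
Proof.
move=> hm; apply: (PT_foldl_add (B := fun=> 2 * q)) _ (PT_nil _ _) hm (polyb_const _ _) _.
  by apply: PT_cat; [exact: PT_constant|pt].
move=> x r _; elim: q => [|q IH]; first by rewrite addn0.
rewrite /= csize_cons; have -> : csize false = 1 by []. lia.
Qed.

Lemma PT_unary (A : Type) (cA : Code A) (Es : A -> seq (seq word)) : PT Es -> PT (fun x => unary (Es x)).
Proof.
move=> h; apply: PT_bitlen; apply: (PT_map (f := fun _ _ => true)) (PT_true _) _.
exact: PT_flatten.
Qed.

(** Two to the binary length of a positive number is at most twice that number, and [k] is a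
    constant exponent. *)
Lemma polyb_unary (A : Type) (cA : Code A) (Es : A -> seq (seq word)) k : PT Es ->
  polyb (fun x => (2 ^ k) ^ size (unary (Es x))).
Proof.
move=> h; have [sz _] := PT_flatten h.
apply: polyb_le (_ : polyb (fun x => (2 * csize (flatten (Es x))) ^ k)) _.
  by apply: polyb_exp; apply: polyb_mul (polyb_const _ _) _.
move=> x; rewrite -expnM mulnC expnM; case: k => // k; rewrite leq_exp2r //.
rewrite /unary; set l := [seq true | _ <- _].
have sl : size l < csize (flatten (Es x)) by rewrite size_map; apply: size_csize.
have [->|/size_bitlen] := eqVneq l [::].
  by rewrite muln_gt0 /=; exact: dsize_gt0.
by case/andP=> _ h'; apply: leq_trans h' _; rewrite leq_mul2l (ltnW sl) orbT.
Qed.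

Lemma PT_points (A : Type) (cA : Code A) k t (Es : A -> seq (seq word)) :
  PT Es -> PT (fun x => points (2 ^ k) t (Es x)).
Proof.
move=> h; have hu := PT_unary h.
have ha : PT (fun x => assoc (2 ^ k) t (Es x)).
  apply: PT_zip; first exact: PT_flatten.
  apply: PT_greedy => //; apply: PT_words => //; first by rewrite expn_gt0.
  exact: polyb_unary.
have hz := PT_zeros (2 ^ k) hu.
apply: (PT_map (f := fun x T => point (assoc (2 ^ k) t (Es x)) (zeros (2 ^ k) (unary (Es x))) T)) => //.
by apply: PT_point; [apply: (PT_comp _ ha); pt|apply: (PT_comp _ hz); pt|pt].
Qed.

(** * The greedy code *)

Definition overlap (c w : word) : nat := count (fun p : bool * bool => p.1 && p.2) (zip c w).

Lemma farE t m c w : far t m c w = (t * overlap c w < size m).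
Proof.
rewrite /far /overlap /nilp.
have -> : forall r : seq bool, size (foldl (fun r (p : bool * bool) =>
    if p.1 && p.2 then drop t r else r) r (zip c w)) =
    size r - t * count (fun p : bool * bool => p.1 && p.2) (zip c w); last by lia.
elim: (zip c w) => [|p s IH] r /=; first by rewrite muln0 subn0.
rewrite IH mulnDr; case: (p.1 && p.2); rewrite ?size_drop ?muln1 ?muln0 ?add0n //.
by rewrite subnDA.
Qed.

Lemma overlapC c w : overlap c w = overlap w c.
Proof.
rewrite /overlap; elim: c w => [|a c IH] [|b w] //=; by rewrite IH andbC.
Qed.

Lemma overlap_id c : overlap c c = count id c.
Proof. by rewrite /overlap; elim: c => //= a c ->; rewrite andbb. Qed.

Lemma overlap_cat c1 w1 c2 w2 : size c1 = size w1 ->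
  overlap (c1 ++ c2) (w1 ++ w2) = overlap c1 w1 + overlap c2 w2.
Proof. by move=> h; rewrite /overlap zip_cat // count_cat. Qed.

Lemma overlap_onehot q i j : i < q ->
  overlap [seq i == l | l <- iota 0 q] [seq j == l | l <- iota 0 q] = (i == j).
Proof.
move=> hi; rewrite /overlap zip_map count_map.
have [<-|ne] := eqVneq i j; last first.
  rewrite (eq_count (a2 := pred0)) ?count_pred0 // => l /=.
  by apply/negbTE/negP => /andP[/eqP h1 /eqP h2]; rewrite h1 h2 eqxx in ne.
rewrite (eq_count (a2 := pred1 i)) => [|l /=]; last by rewrite andbb eq_sym.
by rewrite count_uniq_mem ?iota_uniq // mem_iota add0n hi.
Qed.

Lemma count_word q m w : w \in words q m -> count id w = size m.
Proof.
elim/last_ind: m w => [|m b IH] w; first by rewrite inE => /eqP->.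
rewrite words_cat => /flattenP [s /mapP [v hv ->] /mapP [o /mapP[i hi ->] ->]].
rewrite mem_iota add0n /= in hi.
by rewrite count_cat (IH _ hv) size_rcons -overlap_id overlap_onehot // eqxx.
Qed.

(* The generating function of the overlaps with a fixed word is [(2q - 1)^m]. *)
Lemma sum_overlap q m c : c \in words q m ->
  \sum_(w <- words q m) q ^ overlap c w <= (2 * q) ^ size m.
Proof.
elim/last_ind: m c => [|m b IH] c; first by rewrite inE => /eqP->; rewrite big_seq1.
rewrite words_cat => /flattenP [s /mapP [v hv ->] /mapP [o /mapP[i hi ->] ->]].
rewrite mem_iota add0n /= in hi.
rewrite /wstep big_flatten big_map /=.
(* A new letter multiplies the sum by [q] for the one equal letter plus 1 for each of the [q - 1]
   others. *)
rewrite (eq_bigr (fun w => (q + (q - 1)) * q ^ overlap v w)) => [|w _].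
  rewrite -big_distrr /= size_rcons expnS leq_mul ?IH //; lia.
rewrite big_map /onehots big_map.
rewrite (eq_bigr (fun j => q ^ (i == j) * q ^ overlap v w)) => [|j _]; last first.
  by rewrite overlap_cat ?size_map ?size_iota // overlap_onehot // expnD.
rewrite -big_distrl /=; congr (_ * _).
rewrite (bigD1_seq i) /= ?mem_iota ?iota_uniq ?add0n // eqxx expn1; congr (_ + _).
rewrite (eq_bigr (fun=> 1)) => [|j /negbTE]; last by rewrite eq_sym => ->.
rewrite sum1_count.
have := count_predC (pred1 i) (iota 0 q).
rewrite count_uniq_mem ?iota_uniq // mem_iota add0n hi /= size_iota => h.
by rewrite -[in RHS]h add1n subn1.
Qed.

(** Markov's inequality for [sum_overlap]: a word that is not far has [t * overlap >= m], so with
    [q = 2 ^ (2 * t)] it contributes at least [4 ^ m] to a sum of at most [2 ^ m * q ^ m]. *)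
Lemma count_near t m c : c \in words (2 ^ (2 * t)) m ->
  count (fun w => ~~ far t m c w) (words (2 ^ (2 * t)) m) * 2 ^ size m
    <= (2 ^ (2 * t)) ^ size m.
Proof.
set q := 2 ^ _ => hc; have := sum_overlap hc.
set N := count _ _ => h.
have h1 : N * (2 ^ size m * 2 ^ size m) <= \sum_(w <- words q m) q ^ overlap c w.
  rewrite /N -sum1_count big_distrl /= big_mkcond /=; apply: leq_sum => w _.
  rewrite farE -leqNgt; case: ifP => // hw.
  rewrite mul1n -expnD addnn -mul2n /q -expnM leq_pexp2l //; lia.
have := leq_trans h1 h; rewrite expnMn mulnA [X in _ <= X]mulnC leq_mul2r.
by rewrite expn_eq0.
Qed.

(** The last clause is maximality: a rejected word is near a kept one, and a kept word is near
    itself by hypothesis. *)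
Lemma greedyP t m (ws : seq word) (ch := greedy t m ws) :
  (forall w, w \in ws -> ~~ far t m w w) ->
  [/\ {subset ch <= ws}, pairwise (far t m) ch &
    forall w, w \in ws -> exists2 c, c \in ch & ~~ far t m c w].
Proof.
have fsym a b : far t m a b = far t m b a by rewrite !farE overlapC.
rewrite /ch {ch}; elim/last_ind: ws => [|ws v IH] hf; first by split.
have [|s1 s2 s3] := IH; first by move=> w hw; apply: hf; rewrite mem_rcons inE hw orbT.
rewrite /greedy -cats1 foldl_cat /= -/(greedy t m ws) /gstep.
have sub : {subset ws <= ws ++ [:: v]} by move=> x; rewrite mem_cat => ->.
case: ifP => h.
  split.
  - by move=> x; rewrite inE => /orP[/eqP->|/s1/sub//]; rewrite mem_cat inE eqxx orbT.
  - by rewrite /= s2 andbT; apply/allP => x hx; rewrite fsym; exact: (allP h).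
  move=> w; rewrite mem_cat => /orP[/s3[c hc hcw]|].
    by exists c => //; rewrite inE hc orbT.
  rewrite inE => /eqP->; exists v; first by rewrite inE eqxx.
  by apply: hf; rewrite mem_rcons inE eqxx.
split=> // [x /s1/sub//|w]; rewrite mem_cat => /orP[/s3//|].
rewrite inE => /eqP->; move/negbT: h; rewrite -has_predC => /hasP [c hc hcv].
by exists c.
Qed.

(** The Gilbert-Varshamov argument: the neighbourhoods of the kept words cover all [q ^ m] words,
    and each contains at most a fraction [2 ^ -m] of them. *)
Lemma size_greedy t m (ch := greedy t m (words (2 ^ (2 * t)) m)) : 0 < t ->
  [/\ {subset ch <= words (2 ^ (2 * t)) m}, pairwise (far t m) ch & 2 ^ size m <= size ch].
Proof.
move=> t0; set q := 2 ^ _.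
have [|s1 s2 s3] := @greedyP t m (words q m).
  move=> w hw; rewrite farE overlap_id (count_word hw) -leqNgt.
  by rewrite leq_pmull.
rewrite -/ch in s1 s2 s3; split=> //.
have q0 : 0 < q ^ size m by rewrite expn_gt0 expn_gt0.
rewrite -(leq_pmul2r q0).
have : q ^ size m <= \sum_(c <- ch) count (fun w => ~~ far t m c w) (words q m).
  rewrite -(size_words q m) -sum1_size.
  under [X in _ <= X]eq_bigr => c _ do rewrite -sum1_count big_mkcond.
  rewrite exchange_big /= big_seq [X in _ <= X]big_seq; apply: leq_sum => w /s3 [c hc hw].
  by rewrite (big_rem c) //= hw leq_addr.
move/(leq_mul (leqnn (2 ^ size m)))/leq_trans; apply.
rewrite mulnC big_distrl /= big_seq.
apply: leq_trans (_ : \sum_(c <- ch | c \in ch) q ^ size m <= _).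
  by apply: leq_sum => c /s1 /count_near.
by rewrite -big_seq big_const_seq count_predT iter_addn_0 mulnC.
Qed.

(** * Centers against unions of code words *)

Lemma card_bigcup_le (I T : finType) (P : pred I) (F : I -> {set T}) :
  #|\bigcup_(i | P i) F i| <= \sum_(i | P i) #|F i|.
Proof.
elim/big_rec2: _ => [|i n A _ h]; first by rewrite cards0.
by apply: leq_trans (leq_card_setU _ _) _; rewrite leq_add2l.
Qed.

Lemma bin_le_exp n k : 'C(n, k) <= n ^ k.
Proof.
apply: leq_trans (_ : n ^_ k <= _).
  by rewrite -bin_ffact leq_pmulr ?fact_gt0.
elim: k n => [|k IH] n; first by rewrite ffactn0.
rewrite ffactnS expnS leq_mul2l; apply/orP; right; apply: leq_trans (IH _) _.
by case: k {IH} => // k; rewrite leq_exp2r // leq_pred.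
Qed.

Lemma ex_subset (T : finType) (A : {set T}) k : k <= #|A| ->
  exists B : {set T}, B \subset A /\ #|B| == k.
Proof.
rewrite -bin_gt0 -cards_draws => /card_gt0P [B]; rewrite inE => /andP[h1 h2].
by exists B.
Qed.

(** Such a [T] contains a subset of [H] with [y + 1] elements; there are at most [2 ^ #|H|] of
    these, and each leaves only [z - y - 1] elements of [T] to choose. *)
Lemma count_heavy (U : finType) (H : {set U}) (z y : nat) :
  #|[set T : {set U} | (#|T| == z) && (y < #|T :&: H|)]| <= 2 ^ #|H| * #|U| ^ (z - y - 1).
Proof.
pose F (B : {set U}) := [set T : {set U} | (#|T| == z) && (B \subset T)].
pose Q (B : {set U}) := (B \subset H) && (#|B| == y.+1).
have hF B : Q B -> #|F B| <= #|U| ^ (z - y - 1).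
  case/andP => _ /eqP hB.
  have inj : {in F B &, injective (fun T => T :\: B)}.
    move=> T1 T2; rewrite !inE => /andP[_ h1] /andP[_ h2] e.
    by rewrite -(setID T1 B) -(setID T2 B) e (setIidPr h1) (setIidPr h2).
  rewrite -(card_in_imset inj).
  apply: leq_trans (_ : #|[set T : {set U} | #|T| == z - y - 1]| <= _).
    apply: subset_leq_card; apply/subsetP => _ /imsetP[T hT ->].
    move: hT; rewrite !inE => /andP[/eqP hz hBT].
    by rewrite cardsD (setIidPr hBT) hz hB -addn1 subnDA.
  have -> : [set T : {set U} | #|T| == z - y - 1] =
      [set T : {set U} | T \subset setT & #|T| == z - y - 1].
    by apply/setP => T; rewrite !inE subsetT.
  by rewrite cards_draws cardsT bin_le_exp.
apply: leq_trans (_ : #|\bigcup_(B | Q B) F B| <= _).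
  apply: subset_leq_card; apply/subsetP => T; rewrite inE => /andP[hz hy].
  have /ex_subset : y.+1 <= #|T :&: H| by [].
  move=> [B [sB cB]]; apply/bigcupP; exists B.
    by rewrite /Q cB andbT; apply: subset_trans sB (subsetIr _ _).
  by rewrite inE hz; apply: subset_trans sB (subsetIl _ _).
apply: leq_trans (card_bigcup_le _ _) _.
apply: leq_trans (leq_sum _ hF) _.
rewrite sum_nat_const leq_mul2r -card_powerset; apply/orP; right.
by apply: subset_leq_card; apply/subsetP => B; rewrite inE => /andP[].
Qed.

Section Geometry.
Context (U X : finType) (V : U -> {set X}) (D : {set U}) (C : {set X}) (m ov : nat).
Hypothesis hV : forall u, u \in D -> #|V u| = m.
Hypothesis hov : forall u w, u \in D -> w \in D -> u != w -> #|V u :&: V w| <= ov.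

Definition cover_of (T : {set U}) : {set X} := \bigcup_(u in T) V u.

Definition sdist (A B : {set X}) : nat := #|A :\: B| + #|B :\: A|.

(** Truncated inclusion-exclusion: what is counted more than once lies in pairwise intersections, of
    which [#|A| ^ 2] is a crude but sufficient count. *)
Lemma bonferroni (A : {set U}) (B : {set X}) : A \subset D ->
  \sum_(u in A) #|V u :&: B| <= #|cover_of A :&: B| + #|A| ^ 2 * ov.
Proof.
move e : #|A| => k; elim: k A e => [|k IH] A e sA.
  by rewrite (cards0_eq e) big_set0.
have [u hu] : exists u, u \in A by apply/card_gt0P; rewrite e.
have eA : #|A :\ u| = k by move: e; rewrite (cardsD1 u) hu; case.
have sA' : A :\ u \subset D by apply: subset_trans sA; exact: subsetDl.
rewrite (big_setD1 u hu) /= /cover_of (big_setD1 u hu) /= -/(cover_of _).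
have := IH _ eA sA'; rewrite setIUl cardsU.
set W := cover_of _; have : #|V u :&: B :&: (W :&: B)| <= k * ov.
  apply: leq_trans (_ : #|\bigcup_(w in A :\ u) (V u :&: V w)| <= _).
    rewrite -big_distrr /=; apply: subset_leq_card.
    by apply: setISS; apply: subsetIl.
  apply: leq_trans (card_bigcup_le _ _) _; rewrite -eA -sum_nat_const.
  apply: leq_sum => w; rewrite in_setD1 => /andP[ne hw].
  by apply: hov; rewrite 1?eq_sym ?(subsetP sA).
have : #|V u :&: B :&: (W :&: B)| <= #|V u :&: B| by apply: subset_leq_card; exact: subsetIl.
have -> : k.+1 ^ 2 * ov = k ^ 2 * ov + k * ov + k * ov + ov by rewrite -!mulnn; nia.
lia.
Qed.

Variables (th : nat).
Definition heavy : {set U} := [set u in D | th < #|V u :&: C|].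

Lemma weight_le (T : {set U}) : T \subset D ->
  \sum_(u in T) #|V u :&: C| <= #|T :&: heavy| * m + #|T| * th.
Proof.
move=> sT; rewrite (big_setID heavy) /=; apply: leq_add.
  rewrite -sum_nat_const; apply: leq_sum => u; rewrite !inE => /andP[_ /andP[hu _]].
  by rewrite -(hV hu); apply: subset_leq_card; exact: subsetIl.
apply: leq_trans (_ : #|T :\: heavy| * th <= _); last first.
  by rewrite leq_mul2r subset_leq_card ?orbT // subsetDl.
rewrite -sum_nat_const; apply: leq_sum => u; rewrite !inE => /andP[h hu].
by move: h; rewrite (subsetP sT _ hu) /= -leqNgt.
Qed.

Lemma card_cover (T : {set U}) : T \subset D ->
  #|T| * m <= #|cover_of T| + #|T| ^ 2 * ov /\ #|cover_of T| <= #|T| * m.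
Proof.
move=> sT; split.
  have := bonferroni setT sT; rewrite setIT; apply: leq_trans.
  rewrite -sum_nat_const; apply: leq_sum => u hu.
  by rewrite setIT hV // (subsetP sT).
apply: leq_trans (card_bigcup_le _ _) _; rewrite -sum_nat_const.
by apply: leq_sum => u hu; rewrite hV // (subsetP sT).
Qed.

Lemma card_coverI (T : {set U}) : #|cover_of T :&: C| <= \sum_(u in T) #|V u :&: C|.
Proof. by rewrite /cover_of big_distrl /=; exact: card_bigcup_le. Qed.

(** Already the points of the union missed by [C] suffice: a heavy element hands at most [m] points
    to [C], a light one at most [th]. *)
Lemma sdist_ge (T : {set U}) : T \subset D ->
  #|T| * m <= sdist (cover_of T) C + #|T :&: heavy| * m + #|T| * th + #|T| ^ 2 * ov.
Proof.
move=> sT; have [h _] := card_cover sT; have := card_coverI T; have := weight_le sT.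
have := cardsID C (cover_of T); rewrite /sdist; lia.
Qed.

(* [|P :&: C| + |P' :&: C| <= |C| + |P :&: P' :&: C|]: the two distances together pay twice
   for [C], so that only the part of [C] common to both unions brings a gain. *)
Lemma sdist_pair (T T' : {set U}) z : T \subset D -> T' \subset D -> #|T| = z -> #|T'| = z ->
  2 * (z * m) <= sdist (cover_of T) C + sdist (cover_of T') C
    + 2 * (#|T :&: T' :&: heavy| * m) + 2 * (2 * z ^ 2 * ov + z * th).
Proof.
move=> sT sT' cT cT'.
have [h _] := card_cover sT; have [h' _] := card_cover sT'; rewrite cT in h; rewrite cT' in h'.
set P := cover_of T; set P' := cover_of T'; rewrite -/P in h; rewrite -/P' in h'.
(* A point common to both unions lies in the code word of a common element or in the intersection of
   two different code words. *)
have common : #|P :&: P' :&: C| <= #|T :&: T' :&: heavy| * m + z * th + z ^ 2 * ov.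
  have s1 : P :&: P' :&: C \subset (cover_of (T :&: T') :&: C)
      :|: \bigcup_(p in setX T T' | p.1 != p.2) (V p.1 :&: V p.2).
    apply/subsetP => x; rewrite !inE => /andP[/andP[/bigcupP[u hu xu] /bigcupP[w hw xw]] xC].
    have [e|ne] := eqVneq u w.
      apply/orP; left; rewrite xC andbT; apply/bigcupP; exists u => //.
      by rewrite inE hu e.
    apply/orP; right; apply/bigcupP; exists (u, w); rewrite ?inE /= ?hu ?hw ?ne //.
    by rewrite xu.
  apply: leq_trans (subset_leq_card s1) _; apply: leq_trans (leq_card_setU _ _) _.
  apply: leq_add.
    have sTT : T :&: T' \subset D by apply: subset_trans sT; exact: subsetIl.
    apply: leq_trans (card_coverI _) _; apply: leq_trans (weight_le sTT) _.
    by rewrite leq_add2l leq_mul2r -cT subset_leq_card ?orbT // subsetIl.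
  apply: leq_trans (card_bigcup_le _ _) _.
  apply: leq_trans (_ : \sum_(p in setX T T') ov <= _).
    rewrite big_mkcondr /=; apply: leq_sum => -[u w]; rewrite inE /= => /andP[hu hw].
    by case: ifP => // ne; apply: hov ne; [exact: (subsetP sT)|exact: (subsetP sT')].
  by rewrite sum_nat_const cardsX cT cT' mulnn.
have := cardsID C P; have := cardsID C P'; have := cardsID P C; have := cardsID P' C.
have : #|C :&: P :|: C :&: P'| <= #|C|.
  by apply: subset_leq_card; rewrite subUset !subsetIl.
rewrite cardsU; have : #|C :&: P :&: (C :&: P')| <= #|C :&: P| by apply: subset_leq_card; exact: subsetIl.
have -> : C :&: P :&: (C :&: P') = P :&: P' :&: C.
  by apply/setP => x; rewrite !inE; case: (x \in C); case: (x \in P); rewrite ?andbF ?andbT.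
rewrite (setIC C P) (setIC C P') /sdist; lia.
Qed.

(** Nearly disjoint heavy elements make [C] have almost [#|A| * th] points, whereas the union for
    [T] has at most [#|T| * m]. *)
Lemma sdist_far (A T : {set U}) : A \subset heavy -> T \subset D ->
  #|A| * th <= sdist (cover_of T) C + #|T| * m + #|A| ^ 2 * ov.
Proof.
move=> sA sT.
have sAD : A \subset D.
  by apply: subset_trans sA _; apply/subsetP => u; rewrite inE => /andP[].
have := bonferroni C sAD; have [_ h2] := card_cover sT.
have : #|A| * th <= \sum_(u in A) #|V u :&: C|.
  rewrite -sum_nat_const; apply: leq_sum => u /(subsetP sA); rewrite inE => /andP[_].
  exact: ltnW.
have : #|cover_of A :&: C| <= #|C| by apply: subset_leq_card; exact: subsetIr.
have := cardsID (cover_of T) C.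
have : #|C :&: cover_of T| <= #|cover_of T| by apply: subset_leq_card; exact: subsetIr.
rewrite /sdist; lia.
Qed.

(** The desired lower bounds on the distance, up to the slack [s] from overlaps and light elements;
    [s] is added to [d] to avoid truncated subtraction. *)
Definition good (z y : nat) (S T : {set U}) : bool :=
  let s := 2 * z ^ 2 * ov + z * th in let d := sdist (cover_of T) C in
  ((z - y) * m <= d + s) && ((S \subset T) || ((z - y + 1) * m <= d + s)).

Lemma center_gap (E : {set {set U}}) (z y h : nat) : 0 < y -> y < z ->
  E != set0 -> (forall T, T \in E -> #|T| = z /\ T \subset D) ->
  2 * (z * m) + h ^ 2 * ov <= h * th ->
  exists S : {set U}, #|S| = y /\
    #|[set T in E | ~~ good z y S T]| <= 2 ^ h * #|U| ^ (z - y - 1).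
Proof.
move=> y0 yz /set0Pn [T1 hT1] hE hh.
(* A placeholder of the right size for the cases in which [C] is close to no point that matters. *)
have [S0 [_ cS0]] : exists S : {set U}, S \subset T1 /\ #|S| = y.
  have /ex_subset [S [s1 s2]] : y <= #|T1| by rewrite (hE _ hT1).1 ltnW.
  by exists S; split=> //; apply/eqP.
set s := 2 * z ^ 2 * ov + z * th.
(* With [h] heavy elements every distance is at least [z * m], which implies both bounds in [good]
   because [y] is positive. *)
have [hh1|hh1] := leqP h #|heavy|.
  have /ex_subset [A [sA cA]] := hh1.
  exists S0; split=> //; rewrite (_ : [set T in E | _] = set0) ?cards0 //.
  apply/setP => T; rewrite !inE; apply/negP => /andP[hT /negP]; apply.
  have [cT sT] := hE _ hT; have := sdist_far sA sT.
  rewrite (eqP cA) cT /good -/s => h1.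
  have h2 : z * m <= sdist (cover_of T) C by lia.
  have h3 : (z - y) * m <= z * m by rewrite leq_mul2r leq_subr orbT.
  have h4 : (z - y + 1) * m <= z * m by rewrite leq_mul2r; apply/orP; right; lia.
  by apply/andP; split; [|apply/orP; right]; lia.
have [S [cS hS]] : exists S : {set U}, #|S| = y /\ forall T, T \in E ->
    #|T :&: heavy| <= y -> good z y S T.
  have gen T : T \in E -> #|T :&: heavy| <= y -> (z - y) * m <= sdist (cover_of T) C + s.
    move=> hT hy; have [cT sT] := hE _ hT; have := sdist_ge sT; rewrite cT /s.
    have : #|T :&: heavy| * m <= y * m by rewrite leq_mul2r hy orbT.
    rewrite mulnBl; lia.
  have gen' T : T \in E -> #|T :&: heavy| < y -> (z - y + 1) * m <= sdist (cover_of T) C + s.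
    move=> hT hy; have [cT sT] := hE _ hT; have := sdist_ge sT; rewrite cT /s.
    have : #|T :&: heavy| * m <= (y - 1) * m by rewrite leq_mul2r; apply/orP; right; lia.
    have -> : z - y + 1 = z - (y - 1) by lia.
    rewrite [(z - _) * m]mulnBl; lia.
  (* If some near [T0] has exactly [y] heavy elements, these form [S]. Another near [T] with [y]
     heavy elements but not containing [S] shares at most [y - 1] of them with [T0], and
     [sdist_pair] then bounds the sum of the two distances from below. *)
  have [/existsP[T0 /and3P[h1 /eqP h2 h3]]|/existsPn none] := boolP [exists T0 : {set U},
      [&& T0 \in E, #|T0 :&: heavy| == y & sdist (cover_of T0) C + s < (z - y + 1) * m]].
    exists (T0 :&: heavy); split=> // T hT hy; rewrite /good -/s gen //=.
    apply/orP; have [e|ne] := eqVneq #|T :&: heavy| y; last first.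
      by right; apply: gen' => //; rewrite ltn_neqAle ne.
    have [e2|ne2] := boolP (T0 :&: heavy \subset T); first by left.
    right; rewrite leqNgt; apply/negP => h4.
    have [cT sT] := hE _ hT; have [cT0 sT0] := hE _ h1.
    have := sdist_pair sT sT0 cT cT0; rewrite -/s.
    have lt : #|T :&: T0 :&: heavy| < y.
      rewrite -h2; apply: proper_card; rewrite properE; apply/andP; split.
        by rewrite -setIA subsetIr.
      apply: contra ne2 => /subset_trans; apply.
      by rewrite -setIA subsetIl.
    have : #|T :&: T0 :&: heavy| * m <= (y - 1) * m by rewrite leq_mul2r; apply/orP; right; lia.
    have : (z - y + 1) * m + (y - 1) * m = z * m by rewrite -mulnDl; congr (_ * _); lia.
    lia.
  exists S0; split=> // T hT hy; rewrite /good -/s gen //=; apply/orP; right.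
  have [e|ne] := eqVneq #|T :&: heavy| y; last by apply: gen' => //; rewrite ltn_neqAle ne.
  by have := none T; rewrite hT e eqxx /= -leqNgt.
exists S; split=> //.
apply: leq_trans (_ : 2 ^ #|heavy| * #|U| ^ (z - y - 1) <= _); last first.
  by rewrite leq_mul2r leq_pexp2l ?orbT // ltnW.
apply: leq_trans (count_heavy heavy z y); apply: subset_leq_card; apply/subsetP => T.
rewrite !inE => /andP[hT hg]; rewrite (hE _ hT).1 eqxx /= ltnNge.
by apply: contra hg; exact: hS.
Qed.

End Geometry.

(** * The image of a coverage instance *)

Definition nbits (n : nat) : seq bool :=
  if bin_of_nat n is BinNums.Npos p then bits_of_pos p else [::].

Lemma nbits_inj : injective nbits.
Proof.
have inj : forall p r, bits_of_pos p = bits_of_pos r -> p = r.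
  elim=> [p IH|p IH|] [r|r|] //=.
  - by case=> /IH->.
  - by case; case: p {IH}.
  - by case=> /IH->.
  - by case; case: r.
have ne p : bits_of_pos p <> [::] by case: p.
move=> a b; rewrite /nbits => h; rewrite -(bin_of_natK a) -(bin_of_natK b).
case: (bin_of_nat a) (bin_of_nat b) h => [|p] [|r] //=.
- by move/esym/ne.
- by move/ne.
by move/inj->.
Qed.

(** Since keys may repeat, [j] is just some position of [u]; that the key stored there is [u] is
    enough to give different elements different positions. *)
Lemma lookup_zip (els ch : seq word) u : u \in els -> size els <= size ch ->
  exists2 j, j < size els & nth [::] els j = u /\ lookup (zip els ch) u = nth [::] ch j.
Proof.
rewrite /lookup => hu hs.
have h : forall els ch r, size els <= size ch ->
    let w := foldl (fun r (p : word * word) => if eqbits p.1 u then p.2 else r) r (zip els ch) in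
    (u \notin els -> w = r) /\
    (u \in els -> exists2 j, j < size els & nth [::] els j = u /\ w = nth [::] ch j).
  elim=> [|e l IH]; first by move=> [|? ?] r.
  case=> [//|c l'] r /= hl.
  have [h1 h2] := IH l' (if eqbits e u then c else r) hl.
  split; rewrite inE ?negb_or.
    case/andP=> ne /h1 ->; case: eqbitsP => // e1.
    by rewrite e1 eqxx in ne.
  have [/h2 [j hj [e1 e2]] _|/h1 -> ] := boolP (u \in l); first by exists j.+1.
  rewrite orbF => /eqP e1; exists 0 => //; split=> //=.
  by rewrite e1; case: eqbitsP.
by have [_ /(_ hu)] := h els ch [::] hs.
Qed.

Lemma size_orl r w : size r <= size w -> size (orl r w) = size r.
Proof. by move=> h; rewrite size_map size_zip; apply/minn_idPl. Qed.

Lemma nth_orl r w i : size r <= size w -> nth false (orl r w) i = nth false r i || nth false w i && (i < size r).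
Proof.
move=> h; have [hi|hi] := ltnP i (size r); last first.
  by rewrite andbF orbF !nth_default ?size_orl.
rewrite (nth_map (false, false)) ?size_zip; last by rewrite (minn_idPl h).
by rewrite nth_zip_cond size_zip (minn_idPl h) hi /= andbT.
Qed.

Lemma size_zeros q m : size (zeros q m) = q * size m.
Proof.
rewrite /zeros.
suff -> : forall r, size (foldl (fun r (_ : bool) => nseq q false ++ r) r m) = size r + q * size m by [].
elim: m => [|b m IH] r /=; first by rewrite muln0 addn0.
by rewrite IH size_cat size_nseq mulnS; lia.
Qed.

Lemma nth_zeros q m i : nth false (zeros q m) i = false.
Proof.
rewrite /zeros.
suff h : forall r, (forall i, nth false r i = false) ->
    nth false (foldl (fun r (_ : bool) => nseq q false ++ r) r m) i = false by apply: h => j; rewrite nth_nil.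
elim: m => [|b m IH] r hr //=; apply: IH => j; rewrite nth_cat nth_nseq.
by case: ifP => _; rewrite ?if_same.
Qed.

Lemma point_spec a o T : (forall u, u \in T -> size (lookup a u) = size o) ->
  size (point a o T) = size o /\
  forall i, i < size o ->
    nth false (point a o T) i = nth false o i || has (fun u => nth false (lookup a u) i) T.
Proof.
rewrite /point; elim: T o => [|u T IH] o h /=; first by split=> // i _; rewrite orbF.
have hu : size (lookup a u) = size o by apply: h; rewrite mem_head.
have ho : size (orl o (lookup a u)) = size o by rewrite size_orl ?hu.
have [|h1 h2] := IH (orl o (lookup a u)).
  by move=> v hv; rewrite ho; apply: h; rewrite inE hv orbT.
rewrite ho in h1 h2; split=> // i hi; rewrite h2 // nth_orl ?hu // hi andbT.
by rewrite orbA.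
Qed.

Definition supp d (w : word) : {set 'I_d} := [set i : 'I_d | nth false w i].

Lemma card_supp d w : size w = d -> #|supp d w| = count id w.
Proof.
move=> <-; rewrite -sum1_card -sum1_count (big_nth false) big_mkord.
by apply: eq_bigl => i; rewrite inE.
Qed.

Lemma card_suppI d v w : size v = d -> size w = d -> #|supp d v :&: supp d w| = overlap v w.
Proof.
move=> hv hw; rewrite /overlap -sum1_card -sum1_count (big_nth (false, false)) size_zip hv hw minnn big_mkord.
by apply: eq_bigl => i; rewrite !inE nth_zip ?hv.
Qed.

Definition coll n (s : seq {set 'I_n}) : seq (seq word) :=
  [seq [seq nbits i | i : 'I_n <- enum T] | T : {set 'I_n} <- s].

Section Image.
Variables (z : nat) (I : jc_instance) (s : seq {set 'I_(jc_n I)}) (t : nat).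
Hypothesis validI : jc_valid z I.
Hypothesis enumI : perm_eq s (enum (jc_E I)).
Hypotheses (t0 : 0 < t) (zt : z <= t) (z0 : 0 < z).

Let E := jc_E I.
Let Es := coll s.
Let q := 2 ^ (2 * t).
Definition wt := size (unary (coll s)).
Definition dimI := 2 ^ (2 * t) * wt.
Definition ovI := wt.-1 %/ t.
Definition vect (u : 'I_(jc_n I)) : {set 'I_dimI} := supp dimI (lookup (assoc q t Es) (nbits u)).
(** Elements in no set of the collection are not keys, and [lookup] returns the empty word for them;
    the code-word properties are claimed on [elems] only. *)
Definition elems : {set 'I_(jc_n I)} := cover E.
Definition tup (T : {set 'I_(jc_n I)}) : dimI.-tuple bool := [tuple i \in cover_of vect T | i < dimI].

Lemma memE T : (T \in s) = (T \in E).
Proof. by rewrite (perm_mem enumI) mem_enum. Qed.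

Lemma card_elt T : T \in E -> #|T| = z.
Proof. by case: validI => /subsetP h _ _ /h; rewrite inE => /eqP. Qed.

Lemma subE T : T \in E -> T \subset elems.
Proof. exact: bigcup_sup. Qed.

Lemma size_flat : size (flatten Es) = z * #|E|.
Proof.
rewrite cardE -(perm_size enumI) /Es /coll.
have : forall T : {set _}, T \in s -> #|T| = z by move=> T; rewrite memE; exact: card_elt.
elim: (s) => [|T l IH] h /=; first by rewrite muln0.
rewrite size_cat IH => [|A hA]; last by apply: h; rewrite inE hA orbT.
by rewrite size_map -cardE h ?mem_head // mulnS.
Qed.

Lemma wt_bounds : z * #|E| < 2 ^ wt <= 2 * (z * #|E|).
Proof.
have [_ h _] := validI.
rewrite -size_flat /wt /unary -(size_map (fun=> true)); apply: size_bitlen.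
by rewrite -size_eq0 size_map size_flat; rewrite -lt0n muln_gt0 z0.
Qed.

Lemma wt_gt0 : 0 < wt.
Proof.
have /andP[h _] := wt_bounds; have [_ h' _] := validI.
by rewrite lt0n; apply: contraTN h => /eqP ->; rewrite expn0 -leqNgt muln_gt0 z0.
Qed.

Let ch := greedy t (unary Es) (words q (unary Es)).

Lemma vect_word u : u \in elems ->
  exists2 j, j < size ch & [/\ lookup (assoc q t Es) (nbits u) = nth [::] ch j &
     nth [::] (flatten Es) j = nbits u].
Proof.
case/bigcupP => T hT hu.
have h1 : nbits u \in flatten Es.
  apply/flattenP; exists [seq nbits i | i : 'I_(jc_n I) <- enum T].
    by apply/mapP; exists T; rewrite ?memE.
  by apply/mapP; exists u; rewrite ?mem_enum.
(* The greedy code has at least [2 ^ wt > z * #|E|] words, so the [zip] in [assoc] drops no key. *)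
have h2 : size (flatten Es) <= size ch.
  have [_ _] := size_greedy (unary Es) t0; apply: leq_trans.
  by rewrite size_flat; case/andP: wt_bounds => /ltnW.
have [j hj [e1 e2]] := lookup_zip h1 h2.
by exists j => //; exact: leq_trans hj h2.
Qed.

Lemma ch_words w : w \in ch -> size w = dimI /\ count id w = wt.
Proof.
have [h _ _] := size_greedy (unary Es) t0.
by move/h => hw; rewrite (mem_words hw) (count_word hw).
Qed.

Lemma size_lookup u : u \in elems -> size (lookup (assoc q t Es) (nbits u)) = dimI.
Proof. by case/vect_word => j hj [-> _]; have [] := ch_words (mem_nth [::] hj). Qed.

Lemma card_vect u : u \in elems -> #|vect u| = wt.
Proof.
move=> hu; rewrite card_supp ?size_lookup //.
by have [j hj [-> _]] := vect_word hu; have [] := ch_words (mem_nth [::] hj).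
Qed.

Lemma card_vectI u w : u \in elems -> w \in elems -> u != w -> #|vect u :&: vect w| <= ovI.
Proof.
move=> hu hw ne; rewrite card_suppI ?size_lookup //.
have [i hi [-> ei]] := vect_word hu; have [j hj [-> ej]] := vect_word hw.
rewrite /ovI leq_divRL // mulnC -ltnS (prednK wt_gt0).
have [_ /(pairwiseP [::]) h _] := size_greedy (unary Es) t0.
have ij : i != j.
  apply: contra_neq ne => e; apply/val_inj/nbits_inj; by rewrite -ei -ej e.
have {}h a b : a < b -> b < size ch -> t * overlap (nth [::] ch a) (nth [::] ch b) < wt.
  move=> ab hb; have := h a b; rewrite !inE farE; apply => //; exact: ltn_trans hb.
have [//|lt|e] := ltngtP i j; last by rewrite e eqxx in ij.
  by move=> lt; exact: h.
by rewrite overlapC; exact: h.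
Qed.

Lemma ovI_small : z * ovI < wt.
Proof.
apply: leq_ltn_trans (_ : t * ovI < wt); first by rewrite leq_mul2r zt orbT.
apply: leq_ltn_trans (_ : wt.-1 < wt); last by rewrite ltn_predL wt_gt0.
by rewrite mulnC leq_divM.
Qed.

Lemma points_tup : points q t Es = [seq val (tup T) | T <- s].
Proof.
rewrite /points.
pose f (T : {set 'I_(jc_n I)}) := [seq nbits i | i : 'I_(jc_n I) <- enum T].
rewrite -[[seq _ | T <- Es]]/[seq point (assoc q t Es) (zeros q (unary Es)) T | T <- map f s].
rewrite -map_comp; apply/eq_in_map => T; rewrite memE => hT.
rewrite [LHS]/comp {}/f.
have [|h1 h2] := @point_spec (assoc q t Es) (zeros q (unary Es)) [seq nbits i | i : 'I_(jc_n I) <- enum T].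
  move=> v /mapP[u]; rewrite mem_enum => hu ->; rewrite size_zeros size_lookup //.
  exact: (subsetP (subE hT)).
rewrite size_zeros in h1 h2.
apply: (@eq_from_nth _ false); first by rewrite h1 (size_tuple (tup T)).
move=> i; rewrite h1 => hi; rewrite h2 // nth_zeros /=.
rewrite -[RHS](tnth_nth false (tup T) (Ordinal hi)) tnth_mktuple has_map.
apply/hasP/bigcupP => -[u h h']; exists u; rewrite ?mem_enum // in h *.
  by rewrite inE.
by rewrite inE in h'.
Qed.

Lemma hamming_sdist T (c : dimI.-tuple bool) :
  hamming (tup T) c = sdist (cover_of vect T) [set i | tnth c i].
Proof.
rewrite /hamming /sdist -cardsUI.
have -> : (cover_of vect T :\: [set i | tnth c i]) :&: ([set i | tnth c i] :\: cover_of vect T) = set0.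
  by apply/setP => i; rewrite !inE; case: (tnth c i); case: (i \in _).
rewrite cards0 addn0; apply: eq_card => i; rewrite !inE tnth_mktuple.
by case: (tnth c i); case: (i \in _).
Qed.

(** A code word contained in the union of [z] other ones would have weight at most [z * ovI], which
    [z <= t] makes smaller than [wt]. *)
Lemma tup_inj : {in E &, injective tup}.
Proof.
move=> T T' hT hT' e; apply/eqP; rewrite eqEcard !card_elt // leqnn andbT.
apply/subsetP => u hu; apply: contraT => nu.
have hD : u \in elems by exact: (subsetP (subE hT)).
have eC : cover_of vect T = cover_of vect T'.
  apply/setP => i; have := congr1 (fun a => tnth a i) e; by rewrite /= !tnth_mktuple.
have : #|vect u| <= z * ovI.
  have -> : vect u = vect u :&: cover_of vect T'.
    by rewrite -eC; apply/esym/setIidPl; exact: (bigcup_sup u).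
  rewrite /cover_of big_distrr /=; apply: leq_trans (card_bigcup_le _ _) _.
  rewrite -(card_elt hT') -sum_nat_const; apply: leq_sum => w hw; apply: card_vectI => //.
    exact: (subsetP (subE hT')).
  by apply: contraNneq nu => ->.
by rewrite card_vect // leqNgt ovI_small.
Qed.

Definition image : km_instance := @KMInstance dimI [set tup T | T in E] (jc_k I).

Lemma card_image : #|km_P image| = #|E|.
Proof. exact: card_in_imset tup_inj. Qed.

Lemma image_encodes : km_encodes image (code (points q t Es, nbits (jc_k I))).
Proof.
exists [seq tup T | T <- s]; split.
  apply: uniq_perm; rewrite ?enum_uniq //.
    rewrite map_inj_in_uniq; first by rewrite (perm_uniq enumI) enum_uniq.
    by move=> a b; rewrite !memE; exact: tup_inj.
  move=> a; rewrite mem_enum; apply/mapP/imsetP => -[T hT ->]; exists T => //.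
    by rewrite -memE.
  by rewrite memE.
rewrite code_pair points_tup; congr DCons.
elim: (s) => [|T l IH] //=.
by rewrite code_cons IH.
Qed.

Lemma image_cost sigma :
  @km_cost image sigma = \sum_(T in E) hamming (tup T) (sigma (tup T)) ^ 2.
Proof. exact: (big_imset _ tup_inj). Qed.

Lemma image_complete y : y < z -> jc_complete y I ->
  exists c sigma, @km_assignment image c sigma /\
    @km_cost image sigma <= #|E| * ((z - y) * wt) ^ 2.
Proof.
move=> yz [S [cS hS]]; exists (fun i => tup (S i)).
pose near (a : dimI.-tuple bool) i := hamming a (tup (S i)) <= (z - y) * wt.
have hn T : T \in E -> exists i, near (tup T) i.
  move=> hT; have [i hi] := hS T hT; exists i; rewrite /near hamming_sdist.
  have -> : [set j | tnth (tup (S i)) j] = cover_of vect (S i).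
    by apply/setP => j; rewrite inE tnth_mktuple.
  rewrite /sdist; have -> : cover_of vect (S i) :\: cover_of vect T = set0.
    apply/eqP; rewrite setD_eq0; apply/bigcupsP => u hu.
    by apply: (bigcup_sup u); exact: (subsetP hi).
  rewrite cards0 addn0; apply: leq_trans (_ : #|cover_of vect (T :\: S i)| <= _).
    apply: subset_leq_card; apply/subsetP => j; rewrite inE => /andP[nj /bigcupP[u hu hj]].
    apply/bigcupP; exists u; rewrite // inE hu andbT.
    by apply: contra nj => hu'; apply/bigcupP; exists u.
  apply: leq_trans (card_bigcup_le _ _) _.
  have -> : z - y = #|T :\: S i| by rewrite cardsD (setIidPr hi) card_elt // cS.
  rewrite -sum_nat_const; apply: leq_sum => u; rewrite inE => /andP[_ hu].
  by rewrite card_vect // (subsetP (subE hT)).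
(* The default [a] only makes [sigma] total: by [hn] it is never reached on a point of the image. *)
exists (fun a => if [pick i | near a i] is Some i then tup (S i) else a); split.
  move=> _ /imsetP[T hT ->]; case: pickP => [i _|none]; first by exists i.
  by have [i] := hn T hT; rewrite none.
rewrite image_cost -sum_nat_const; apply: leq_sum => T hT; rewrite leq_exp2r //.
case: pickP => [i //|none]; by have [i] := hn T hT; rewrite none.
Qed.

(** Each center yields one set by [center_gap], and [B] collects the exceptional sets of all [k]
    centers. *)
Lemma image_sound y h th c sigma : 0 < y -> y < z ->
  2 * (z * wt) + h ^ 2 * ovI <= h * th -> @km_assignment image c sigma ->
  let sl := 2 * z ^ 2 * ovI + z * th in
  exists (S : 'I_(jc_k I) -> {set 'I_(jc_n I)}) (B : {set {set 'I_(jc_n I)}}),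
  [/\ forall i, #|S i| = y, #|B| <= jc_k I * (2 ^ h * jc_n I ^ (z - y - 1)) &
    forall T, T \in E :\: B -> let d := hamming (tup T) (sigma (tup T)) in
     (z - y) * wt <= d + sl /\ (T \in jc_covered S \/ (z - y + 1) * wt <= d + sl)].
Proof.
move=> y0 yz hh hs sl.
have [_ E0 _] := validI.
have hE T : T \in E -> #|T| = z /\ T \subset elems by move=> hT; rewrite card_elt // subE.
have ne : E != set0 by rewrite -card_gt0.
pose C i := [set j | tnth (c i) j].
have gap i := center_gap (C i) card_vect card_vectI y0 yz ne hE hh.
have [S hS] := choice gap.
exists S, (\bigcup_i [set T in E | ~~ good vect (C i) wt ovI th z y (S i) T]); split.
- by move=> i; case: (hS i).
- apply: leq_trans (card_bigcup_le _ _) _.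
  rewrite -[X in X * _]card_ord -sum_nat_const; apply: leq_sum => i _.
  by have [_] := hS i; rewrite card_ord.
move=> T; rewrite inE => /andP[nB hT] d.
have [i hi] := hs (tup T) (imset_f _ hT).
have : good vect (C i) wt ovI th z y (S i) T.
  by apply: contraNT nB => ng; apply/bigcupP; exists i; rewrite // inE hT.
rewrite /good -/sl -hamming_sdist -hi => /andP[h1 /orP h2]; split=> //.
case: h2 => h2; [left|by right].
by rewrite inE hT; apply/existsP; exists i.
Qed.

End Image.

(** * Transfer of hardness *)

Lemma dsize_eval e s : dsize (eval e s) <= expr_cost e s.
Proof. by case: e => *; exact: leq_addl. Qed.

(** Bounds the output of a reduction by its running time, so that a second program run on it is
    polynomial in the original input. *)
Lemma exec_size c s s' t : exec c s s' t -> forall i, dsize (s' i) <= dsize (s i) + t.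
Proof.
elim=> //= {c s s' t}.
- by move=> s i; rewrite leq_addr.
- move=> i e s j; rewrite /update; case: ifP => _; last by rewrite leq_addr.
  by apply: leq_trans (dsize_eval _ _) _; rewrite leq_addl.
- move=> c1 c2 s s1 s2 t1 t2 _ h1 _ h2 i; have := h1 i; have := h2 i; lia.
- move=> e c1 c2 s s1 t _ _ h i; have := h i; lia.
- move=> e c1 c2 s s1 t _ _ h i; have := h i; lia.
- by move=> e c s _ i; rewrite leq_addr.
move=> e c s s1 s2 t1 t2 _ _ h1 _ h2 i; have := h1 i; have := h2 i; lia.
Qed.

Lemma polytime_comp (A B : Type) (cA : Code A) (cB : Code B) (f : seq bool -> data)
    (h : seq bool -> A) (red : A -> B) :
  polytime code_bits f -> (forall x, f x = code (h x)) -> PT red ->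
  polytime code_bits (fun x => code (red (h x))).
Proof.
move=> [c [e hc]] hf [_ /(_ 0) [c' [T [[e' hT] hc']]]].
exists (Seq c c').
pose S (x : seq bool) := dsize (code_bits x).
(* Converts a [polyb] bound to the shape required by [polytime]; inputs of size 1, whose powers do
   not grow, are covered by the additive constant. *)
have bound : exists E, forall x, S x ^ e + e + (S x + (S x ^ e + e) + 1) ^ e' <= S x ^ E + E.
  have [E hE] : polyb (fun x : seq bool => csize x ^ e + e + (csize x + (csize x ^ e + e) + 1) ^ e').
    have h1 : polyb (fun x : seq bool => csize x ^ e + e).
      by apply: polyb_add (polyb_exp _ (polyb_size _)) (polyb_const _ _).
    apply: polyb_add => //; apply: polyb_exp; apply: polyb_add (polyb_const _ _).
    exact: polyb_add (polyb_size _) h1.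
  exists (2 * E + 2 ^ E) => x; apply: leq_trans (hE x) _.
  have -> : csize x = S x by [].
  have : 0 < S x by exact: dsize_gt0.
  case: (S x) => [|[|n]] // _; first by rewrite exp1n; lia.
  apply: leq_trans (_ : n.+2 ^ (2 * E) <= _).
    rewrite expnM; case: E {hE} => // E; rewrite leq_exp2r // -mulnn; nia.
  by apply: leq_trans (leq_addr _ _); rewrite leq_pexp2l // leq_addr.
have [E hE] := bound; exists E => x.
have [s [t [ex hs ht]]] := hc x.
have [s' [t' [ex' [hs' _] ht']]] := hc' (h x) s (etrans hs (hf x)).
exists s', (t + t'); split=> //; first exact: exec_seq ex ex'.
apply: leq_trans (hE x); rewrite -/(S x) in ht; apply: leq_add => //.
apply: leq_trans ht' _; apply: leq_trans (hT _) _.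
case: (e') => // e''; rewrite leq_exp2r // -hf -hs addn1 ltnS.
apply: leq_trans (exec_size ex 0) _; rewrite -[load _ 0]/(code_bits x) -/(S x); lia.
Qed.

(** * Encodings of coverage instances and the table of small ones *)

Lemma PT_has_eq (l : seq data) : PT (fun a : data => has (fun c => `[< a = c >]) l).
Proof.
elim: l => [|c l IH]; first exact: PT_false.
by apply: PT_or IH; exact: PT_eq_data.
Qed.

Lemma code_bool_inj : injective (fun b : bool => code b).
Proof. by case=> -[]. Qed.

Lemma code_seq_inj A (cA : Code A) :
  injective (fun x : A => code x) -> injective (fun s : seq A => code s).
Proof.
move=> h; elim=> [|a u IH] [|b v] //=.
by rewrite !code_cons => -[/h-> /IH->].
Qed.

Definition input := (seq word * (seq (seq word) * word))%type.
Definition jc_input (I : jc_instance) (s : seq {set 'I_(jc_n I)}) : input :=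
  ([seq nbits i | i <- iota 0 (jc_n I)], (coll s, nbits (jc_k I))).

Lemma jc_encodesE I a : jc_encodes I a <->
  exists s : seq {set 'I_(jc_n I)}, perm_eq s (enum (jc_E I)) /\ a = code (jc_input s).
Proof.
have aux : forall l, code_list code_nat l = code [seq nbits i | i <- l].
  by elim=> //= i l ->; rewrite code_cons.
have e (s : seq {set 'I_(jc_n I)}) : DCons (code_list code_nat (iota 0 (jc_n I)))
    (DCons (code_list (fun T : {set 'I_(jc_n I)} =>
      code_list (fun i : 'I_(jc_n I) => code_nat i) (enum T)) s) (code_nat (jc_k I)))
    = code (jc_input s).
  rewrite !code_pair aux; congr (DCons _ (DCons _ _)).
  elim: s => //= T s ->; rewrite code_cons; congr DCons.
  by elim: (enum T) => //= i l ->; rewrite code_cons.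
by split=> -[s [h1 h2]]; exists s; split=> //; rewrite h2 e.
Qed.

Lemma code_input_inj : injective (fun x : input => code x).
Proof.
have w : injective (fun s : word => code s) by exact/code_seq_inj/code_bool_inj.
have ww := code_seq_inj w; have www := code_seq_inj ww.
move=> [a [b c]] [a' [b' c']] /=; rewrite !code_pair.
by case=> /ww-> /www-> /w->.
Qed.

Lemma coll_inj n : injective (@coll n).
Proof.
apply: inj_map => T T' /(inj_map (inj_comp nbits_inj val_inj)) h.
by apply/setP => i; rewrite -mem_enum h mem_enum.
Qed.

Definition small_codes_Ek n (E : {set {set 'I_n}}) (k : nat) : seq data :=
  [seq code (@jc_input (JCInstance E k) s) | s : seq {set 'I_n} <- permutations (enum E)].

Definition small_codes_E n (E : {set {set 'I_n}}) : seq data :=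
  flatten [seq small_codes_Ek E k | k <- iota 0 #|E|].

Definition small_codes n : seq data :=
  flatten [seq small_codes_E E | E <- enum {set {set 'I_n}}].

Section Small.
Context (R : realType) (alpha : R) (z y : nat).
Hypotheses (yz : y < z) (alpha1 : (alpha < 1)%R).

Lemma complete_not_sound I : jc_valid z I -> jc_complete y I -> ~ jc_sound alpha y I.
Proof.
move=> [_ E0 _] [S [cS hS]] /(_ S cS).
have -> : jc_covered S = jc_E I.
  apply/setP => T; rewrite inE; case hT: (T \in jc_E I) => //=.
  by apply/existsP; have [i hi] := hS T hT; exists i.
apply/negP; rewrite -ltNge -[ltRHS]mul1r ltr_pM2r //; by rewrite ltr0n.
Qed.

Lemma large_k_complete I : jc_valid z I -> #|jc_E I| <= jc_k I -> jc_complete y I.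
Proof.
move=> [hE E0 _] hk.
have ex (T : {set 'I_(jc_n I)}) : exists B : {set 'I_(jc_n I)},
    T \in jc_E I -> B \subset T /\ #|B| = y.
  have [hT|_] := boolP (T \in jc_E I); last by exists T.
  have := subsetP hE T hT; rewrite inE => /eqP hz.
  have /ex_subset [B [h1 /eqP h2]] : y <= #|T| by rewrite hz ltnW.
  by exists B.
have [sub hsub] := choice ex.
have [T0 hT0] : exists T, T \in jc_E I by apply/card_gt0P.
(* One subset per member of the collection; surplus indices fall back on [T0] and repeat its
   subset. *)
exists (fun i => sub (nth T0 (enum (jc_E I)) i)); split=> [i|T hT].
  have /hsub[] // : nth T0 (enum (jc_E I)) i \in jc_E I.
  have [h|h] := ltnP i (size (enum (jc_E I))); last by rewrite nth_default.
  by rewrite -mem_enum mem_nth.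
have hi : index T (enum (jc_E I)) < jc_k I.
  by apply: leq_trans hk; rewrite cardE index_mem mem_enum.
exists (Ordinal hi); rewrite /= nth_index ?mem_enum //.
by have [] := hsub _ hT.
Qed.

(* A no-instance on few elements has [k < #|E|], so these have finitely many encodings. *)
Lemma small_table n0 : exists tbl : seq data, forall a, has (fun c => `[< a = c >]) tbl <->
  exists I, [/\ jc_encodes I a, jc_valid z I, jc_sound alpha y I & jc_n I <= n0].
Proof.
pose P a := `[< exists I, [/\ jc_encodes I a, jc_valid z I, jc_sound alpha y I & jc_n I <= n0] >].
exists [seq a <- flatten [seq small_codes n | n <- iota 0 n0.+1] | P a] => a; split.
  elim: (flatten _) => //= c l IH; case: ifP => //= /asboolP hP /orP[/asboolP->//|]; exact: IH.
move=> hI; have hP : P a by apply/asboolP.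
have hin : has (fun c => `[< a = c >]) (flatten [seq small_codes n | n <- iota 0 n0.+1]); last first.
  elim: (flatten _) hin => //= c l IH /orP[/asboolP <-|/IH h]; first by rewrite hP /= asboolT.
  by case: ifP => //= _; rewrite h orbT.
have has_flatten (T : eqType) (f : T -> seq data) (l : seq T) x : x \in l ->
    has (fun c => `[< a = c >]) (f x) -> has (fun c => `[< a = c >]) (flatten [seq f x | x <- l]).
  elim: l => //= x' l IH; rewrite inE has_cat => /orP[/eqP->->//|/IH h /h ->]; exact: orbT.
have [I [/jc_encodesE [s [ps ea]] vI sI hn]] := hI.
have hk : jc_k I < #|jc_E I|.
  by rewrite ltnNge; apply/negP => /(large_k_complete vI) /(complete_not_sound vI).
apply: (has_flatten _ small_codes _ (jc_n I)); first by rewrite mem_iota.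
apply: (has_flatten _ (@small_codes_E (jc_n I)) _ (jc_E I)); first by rewrite mem_enum.
apply: (has_flatten _ (small_codes_Ek (jc_E I)) _ (jc_k I)); first by rewrite mem_iota.
rewrite /small_codes_Ek ea.
have : s \in permutations (enum (jc_E I)) by rewrite mem_permutations.
elim: (permutations _) => //= s' l IH; rewrite inE => /orP[/eqP<-|/IH->]; last exact: orbT.
by rewrite asboolT //; case: (I) s {ps}.
Qed.

(** An encoding determines its instance, and for [alpha < 1] no valid instance is both a yes- and a
    no-instance. *)
Lemma small_table_complete n0 tbl I a :
  (forall a, has (fun c => `[< a = c >]) tbl <->
    exists I, [/\ jc_encodes I a, jc_valid z I, jc_sound alpha y I & jc_n I <= n0]) ->
  jc_encodes I a -> jc_valid z I -> jc_complete y I -> ~~ has (fun c => `[< a = c >]) tbl.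
Proof.
move=> ht /jc_encodesE [s [ps ->]] vI cI; apply/negP => /ht [I' [/jc_encodesE [s' [ps' e]] vI' sI' _]].
move/code_input_inj: e.
case: I s ps vI cI => n E k s /= ps vI cI; case: I' s' ps' vI' sI' => n' E' k' s' /= ps' vI' sI'.
rewrite /jc_input /= => -[e1 e2 /nbits_inj e3].
have en : n = n' by rewrite -(size_iota 0 n) -(size_map nbits) e1 size_map size_iota.
move: E k s ps vI cI e2 e3 {e1}; rewrite en => E k s ps vI cI /coll_inj es ek.
have eE : E = E'.
  by apply/setP => T; rewrite -mem_enum -(perm_mem ps) es (perm_mem ps') mem_enum.
move: vI cI; rewrite eE ek => vI cI; exact: (complete_not_sound vI cI).
Qed.

End Small.

Section Reduction.
Context (R : realType) (alpha : R) (z y t n0 : nat) (Q : promise_problem).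
Hypotheses (yz : y < z) (alpha1 : (alpha < 1)%R).
Variables (yes_out no_out : seq word * word).

(** The table lists the no-instances on at most [n0] elements, so under the promise any other input
    of that size is a yes-instance. The explicitly listed universe lets [drop n0] test the size. *)
Definition reduce (tbl : seq data) (x : input) : seq word * word :=
  if has (fun c => `[< code x = c >]) tbl then no_out
  else if nilp (drop n0 x.1) then yes_out
  else (points (2 ^ (2 * t)) t x.2.1, x.2.2).

Lemma PT_reduce tbl : PT (reduce tbl).
Proof.
apply: PT_if; first exact: (PT_comp (PT_code _) (PT_has_eq tbl)).
  exact: PT_constant.
apply: PT_if; last by apply: PT_pair; [apply: PT_points; pt|pt].
  have h : PT (fun x : input => drop n0 x.1) by apply: PT_drop; pt.
  by apply: PT_ext (PT_neg (PT_nonnil h)) _ => x; rewrite negbK.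
exact: PT_constant.
Qed.

Lemma hard_transfer (A : jc_instance -> Prop) :
  NP_hard (restrict_problem (Q := JohnsonCoverage alpha z y) A) ->
  (exists I : instance Q, encodes I (code yes_out) /\ yes_case I) ->
  (exists I : instance Q, encodes I (code no_out) /\ no_case I) ->
  (forall I (s : seq {set 'I_(jc_n I)}), n0 < jc_n I -> A I -> jc_valid z I ->
     perm_eq s (enum (jc_E I)) -> exists I' : instance Q,
     [/\ encodes I' (code (points (2 ^ (2 * t)) t (coll s), nbits (jc_k I))),
        jc_complete y I -> yes_case I' & jc_sound alpha y I -> no_case I']) ->
  NP_hard Q.
Proof.
move=> hard hyes hno himg L /hard [f [pf fy fn]].
have [tbl ht] := small_table yz alpha1 n0.
(* Whether or not [x] is in [L], [f x] encodes an instance; its decoding [h x] is never computed,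
   since the program acts on the tree [f x] itself. *)
have enc x : exists v : input, f x = code v.
  have [/fy|/fn] := pselect (L x).
    by move=> [I [/jc_encodesE [s [_ ->]] _]]; exists (jc_input s).
  by move=> [I [/jc_encodesE [s [_ ->]] _]]; exists (jc_input s).
have [h hf] := choice enc.
exists (fun x => code (reduce tbl (h x))); split=> [|x Lx|x Lx].
- exact: polytime_comp pf hf (PT_reduce tbl).
- have [I [eI [AI [vI cI]]]] := fy x Lx; rewrite /= in I eI AI vI cI.
  have ntbl := small_table_complete alpha1 ht eI vI cI.
  have [s [ps e]] := (jc_encodesE _ _).1 eI.
  rewrite hf in ntbl e; move/code_input_inj: e => e; rewrite /reduce (negbTE ntbl) e.
  rewrite /nilp size_drop size_map size_iota subn_eq0; case: leqP => // big.
  have [I' [eI' yI' _]] := himg I s big AI vI ps.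
  by exists I'; split=> //; exact: yI'.
have [I [eI [AI [vI sI]]]] := fn x Lx; rewrite /= in I eI AI vI sI.
rewrite /reduce; case: ifP => // ntbl.
have [s [ps e]] := (jc_encodesE _ _).1 eI.
have big : n0 < jc_n I.
  rewrite ltnNge; apply/negP => small; move/negP: ntbl; apply.
  by apply/(ht _).2; exists I; rewrite -hf.
rewrite hf in e; move/code_input_inj: e => ->.
rewrite /nilp size_drop size_map size_iota subn_eq0 leqNgt big /=.
have [I' [eI' _ nI']] := himg I s big AI vI ps.
by exists I'; split=> //; exact: nI'.
Qed.

End Reduction.

(** * Choice of the constants *)

(** From [2 * r <= m], rounding costs at most half: [m <= 2 * r * th], hence
    [h * th >= (2 * z + 1) * m]. One [m] pays for [h ^ 2 * ov], because [t >= h ^ 2]. The summand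
    [2 * z * r] of [t] and the choice of [th] bound each part of the slack by [z * m / r]. *)
Lemma code_params (z r m : nat) (h := 2 * r * (2 * z + 1)) (t := h ^ 2 + 2 * z * r + z + 1)
    (ov := m.-1 %/ t) (th := m %/ r) : 0 < z -> 0 < r -> 2 * r <= m ->
  2 * (z * m) + h ^ 2 * ov <= h * th /\ r * (2 * z ^ 2 * ov + z * th) <= 2 * z * m.
Proof.
move=> z0 r0 hm.
have e1 : ov * t <= m by apply: leq_trans (leq_divM _ _) (leq_pred _).
have e2 : th * r <= m by exact: leq_divM.
have e3 : m < th.+1 * r by rewrite ltn_ceil.
have e4 : h ^ 2 * ov <= m.
  by apply: leq_trans e1; rewrite mulnC leq_mul2l /t -!addnA leq_addr orbT.
have e5 : 2 * z * r * ov <= m.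
  apply: leq_trans e1; rewrite mulnC leq_mul2l; apply/orP; right; rewrite /t; lia.
split.
  have e6 : m <= 2 * (r * th) by lia.
  have : (2 * z + 1) * m <= (2 * z + 1) * (2 * (r * th)) by rewrite leq_mul2l e6 orbT.
  rewrite mulnDl mul1n /h; lia.
have : z * (2 * z * r * ov) <= z * m by rewrite leq_mul2l e5 orbT.
have : z * (th * r) <= z * m by rewrite leq_mul2l e2 orbT.
rewrite -!mulnn; lia.
Qed.

Local Open Scope ring_scope.

Section Constants.
Context (R : realType).

(** Why 20: with [K <= 4 w^2], replacing the right side by [K] costs at most [8 d w^2], and
    [(1 + d)^2 <= 1 + 3 d] on the left costs at most [12 d w^2]. *)
Lemma gap_constant (w alpha eps d : R) : 1 <= w -> 0 <= alpha -> alpha < 1 ->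
  0 < d -> d <= 1 / 2 -> 20 * d <= eps ->
  let G := 1 + (1 - alpha) * (2 * w + 1) / w ^+ 2 - eps in 0 <= G ->
  G * (w ^+ 2 * (1 + d) ^+ 2) <=
    (1 - d) * (w - d) ^+ 2 + (1 - alpha - d) * (2 * (w - d) + 1).
Proof.
move=> w1 a0 a1 d0 d1 de G G0.
have w2 : 1 <= w ^+ 2 by rewrite expr_ge1 //; lra.
set K := w ^+ 2 + (1 - alpha) * (2 * w + 1).
have EG : G * w ^+ 2 = K - eps * w ^+ 2.
  by rewrite /G /K; field; lra.
have ww : w <= w ^+ 2 by rewrite expr2; nra.
have K4 : K <= 4 * w ^+ 2.
  rewrite /K; have : (1 - alpha) * (2 * w + 1) <= 2 * w + 1 by nra.
  lra.
have h1 : K - 8 * d * w ^+ 2 <= (1 - d) * (w - d) ^+ 2 + (1 - alpha - d) * (2 * (w - d) + 1).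
  rewrite /K !expr2; nra.
apply: le_trans h1.
rewrite mulrA EG.
have Kp : 0 <= K - eps * w ^+ 2 by rewrite -EG mulr_ge0 //; lra.
have h2 : (1 + d) ^+ 2 <= 1 + 3 * d by rewrite expr2; nra.
have : (K - eps * w ^+ 2) * (1 + d) ^+ 2 <= (K - eps * w ^+ 2) * (1 + 3 * d).
  exact: ler_wpM2l.
move/le_trans; apply.
have : eps * w ^+ 2 * 1 >= 20 * d * w ^+ 2 by rewrite mulr1 ler_wpM2r //; lra.
have : 0 <= eps * w ^+ 2 by apply: mulr_ge0; lra.
move: Kp; set e := eps * w ^+ 2; set W := w ^+ 2 in K4 ww w2 * => Kp e0 h3.
have : d * (K - e) <= d * (4 * W) by apply: ler_wpM2l; lra.
nra.
Qed.

(** Every point outside [B] pays [(w - d)^2]; those also outside [C] pay in addition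
    [2 (w - d) + 1], the difference between [(w + 1 - d)^2] and [(w - d)^2]. *)
Lemma sum_sqr_ge (T : finType) (E B C : {set T}) (x : T -> nat) (alpha w d m : R) :
  0 <= alpha -> 0 <= d -> d <= 1 / 2 -> 1 <= w -> 0 <= m ->
  #|B|%:R <= d * #|E|%:R -> #|C|%:R <= alpha * #|E|%:R ->
  (forall a, a \in E :\: B -> (w - d) * m <= (x a)%:R /\ (a \in C \/ (w + 1 - d) * m <= (x a)%:R)) ->
  #|E|%:R * m ^+ 2 * ((1 - d) * (w - d) ^+ 2 + (1 - alpha - d) * (2 * (w - d) + 1))
    <= (\sum_(a in E) x a ^ 2)%:R.
Proof.
move=> a0 d0 d1 w1 m0 hB hC hx.
rewrite natr_sum (big_setID B) /=.
apply: le_trans (_ : \sum_(a in E :\: B) (x a ^ 2)%:R <= _); last first.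
  by rewrite lerDr sumr_ge0 // => a _; rewrite ler0n.
set p := (w - d) ^+ 2 * m ^+ 2; set e := (2 * (w - d) + 1) * m ^+ 2.
have e0 : 0 <= e by rewrite mulr_ge0 ?exprn_ge0 //; lra.
have p0 : 0 <= p by rewrite mulr_ge0 ?exprn_ge0 //; lra.
apply: le_trans (_ : \sum_(a in E :\: B) (p + (if a \in C then 0 else e)) <= _); last first.
  apply: ler_sum => a /hx [h1 h2]; rewrite natrX.
  have X0 : 0 <= (w - d) * m by rewrite mulr_ge0 //; lra.
  case: ifPn h2 => [_ _|nC [//|h2]]; last first.
  - apply: le_trans (_ : ((w + 1 - d) * m) ^+ 2 <= _).
      by rewrite /p /e; lra.
    by rewrite lerXn2r ?nnegrE //; nra.
  by rewrite addr0 /p -exprMn lerXn2r ?nnegrE // (le_trans X0).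
rewrite big_split /= sumr_const -[p *+ _]mulr_natl.
have -> : \sum_(a in E :\: B) (if a \in C then 0 else e) = #|(E :\: B) :\: C|%:R * e.
  rewrite (big_setID C) /= big1 ?add0r => [|a]; last by rewrite inE => /andP[_ ->].
  rewrite (eq_bigr (fun=> e)) => [|a]; last by rewrite inE => /andP[/negbTE-> _].
  by rewrite sumr_const mulr_natl.
have n1 : #|E|%:R <= #|E :\: B|%:R + #|B|%:R :> R.
  rewrite -natrD ler_nat -(cardsID B E) addnC leq_add2l.
  by apply: subset_leq_card; exact: subsetIr.
have n2 : #|E :\: B|%:R <= #|(E :\: B) :\: C|%:R + #|C|%:R :> R.
  rewrite -natrD ler_nat -(cardsID C (E :\: B)) addnC leq_add2l.
  by apply: subset_leq_card; exact: subsetIr.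
apply: le_trans (_ : (1 - d) * #|E|%:R * p + (1 - alpha - d) * #|E|%:R * e <= _).
  by rewrite /p /e; lra.
by apply: lerD; apply: ler_wpM2r => //; lra.
Qed.

End Constants.

Local Close Scope ring_scope.

(** * Fixed yes- and no-instances: two antipodal points, with two centers or one *)

Definition two_points (d k : nat) : km_instance :=
  @KMInstance d [set [tuple of nseq d b] | b : bool] k.

Lemma two_points_inj d : 0 < d -> injective (fun b : bool => [tuple of nseq d b]).
Proof.
move=> d0 a b e; have := congr1 (fun u => tnth u (Ordinal d0)) e.
by rewrite !(tnth_nth false) /= !nth_nseq d0.
Qed.

Lemma card_two_points d k : 0 < d -> #|km_P (two_points d k)| = 2.
Proof. by move=> d0; rewrite card_imset ?card_bool //; exact: two_points_inj. Qed.

Lemma two_points_encodes d k : 0 < d ->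
  km_encodes (two_points d k) (code ([:: nseq d false; nseq d true], nbits k)).
Proof.
move=> d0; exists [seq [tuple of nseq d b] | b <- [:: false; true]]; split; last first.
  by rewrite code_pair !code_cons code_nil.
apply: uniq_perm; rewrite ?enum_uniq ?map_inj_uniq //; first exact: two_points_inj.
move=> a; rewrite mem_enum; apply/mapP/imsetP => -[b _ ->]; exists b => //.
by case: b; rewrite !inE.
Qed.

Lemma two_points_cost d k sigma : 0 < d -> @km_cost (two_points d k) sigma =
  hamming [tuple of nseq d false] (sigma [tuple of nseq d false]) ^ 2 +
  hamming [tuple of nseq d true] (sigma [tuple of nseq d true]) ^ 2.
Proof.
move=> d0; rewrite /km_cost big_imset /=; last by move=> a b _ _; exact: two_points_inj.
by rewrite big_bool addnC.
Qed.

Lemma hamming_id d (a : d.-tuple bool) : hamming a a = 0.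
Proof. by apply/eqP; rewrite cards_eq0; apply/eqP/setP => i; rewrite !inE eqxx. Qed.

(** The distances from one center to two antipodal points add up to [d], so their squares sum to at
    least half of [d ^ 2]. *)
Lemma two_points_sound d sigma c : 0 < d -> @km_assignment (two_points d 1) c sigma ->
  d ^ 2 <= 2 * @km_cost (two_points d 1) sigma.
Proof.
move=> d0 h; rewrite two_points_cost //.
have mem b : [tuple of nseq d b] \in km_P (two_points d 1) by apply: imset_f.
have [i e] := h _ (mem false); have [j e'] := h _ (mem true).
have ij : i = j by apply/val_inj; case: i j {e e'} => [[|i] // hi] [[|j] // hj].
rewrite e e' ij; set v := c j.
have : hamming [tuple of nseq d false] v + hamming [tuple of nseq d true] v = d.
  have tn b (l : 'I_d) : tnth [tuple of nseq d b] l = b.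
    by rewrite (tnth_nth b) /= nth_nseq ltn_ord.
  rewrite /hamming -cardsUI; set A := _ :|: _; set B := _ :&: _.
  have -> : B = set0 by apply/setP => l; rewrite !inE !tn; case: (tnth v l).
  have -> : A = setT by apply/setP => l; rewrite !inE !tn; case: (tnth v l).
  by rewrite cards0 addn0 cardsT card_ord.
move: (hamming _ _) (hamming _ _) => a b <-; rewrite sqrnD; have := (nat_Cauchy a b).1; lia.
Qed.

Local Open Scope ring_scope.

(** * The gap for the image of one sufficiently large instance *)

Section Gap.
Context (R : realType) (z y r : nat) (alpha eps d : R).
Hypotheses (y0 : (0 < y)%N) (yz : (y < z)%N) (r0 : (0 < r)%N).
Hypotheses (a0 : 0 <= alpha) (a1 : alpha < 1).
Hypotheses (d0 : 0 < d) (d1 : d <= 1 / 2) (deps : 20 * d <= eps) (dr : 2 * z%:R <= d * r%:R).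

Let w : R := (z - y)%:R.
(* Elements [u] with [|V u :&: C| > m / r] are heavy; [h] of them make [C] so large that it
   is far from every point, and [t] makes the overlaps of [h] code words negligible. *)
Definition gap_h := (2 * r * (2 * z + 1))%N.
Definition gap_t := (gap_h ^ 2 + 2 * z * r + z + 1)%N.
(** The factor [(1 + d)^2] allows for the rounding of [m], which may exceed [ln N / ln 2] by a
    factor up to [1 + d]; completeness needs this upper bound. *)
Definition gap_rho : R := w ^+ 2 * (1 + d) ^+ 2 / ln (2 : R) ^+ 2.
Definition gap_factor : R := 1 + (1 - alpha) * (2 * w + 1) / w ^+ 2 - eps.
Definition gap_dim : R := (2 ^ (2 * gap_t))%N%:R * (1 + d) / ln (2 : R).

Lemma ln2_gt0 : 0 < ln (2 : R).
Proof. by apply: ln_gt0; lra. Qed.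

Lemma w_ge1 : 1 <= w.
Proof. by rewrite /w -[1]/(1%:R) ler_nat subn_gt0. Qed.

Lemma gap_rho_gt0 : 0 < gap_rho.
Proof.
have := w_ge1; have := ln2_gt0 => l0 w1.
have w0 : 0 < w by lra.
have d0' : 0 < 1 + d by rewrite addr_gt0.
by rewrite /gap_rho divr_gt0 ?mulr_gt0 ?exprn_gt0.
Qed.

Section Instance.
Variables (I : jc_instance) (s : seq {set 'I_(jc_n I)}).
Hypotheses (validI : jc_valid z I) (enumI : perm_eq s (enum (jc_E I))).
Hypotheses (E2 : (1 < #|jc_E I|)%N) (logE : ln ((2 * z)%:R : R) <= d * ln (#|jc_E I|%:R : R)).
Hypotheses (wtr : (2 * r <= wt s)%N)
  (few : (jc_k I * (2 ^ gap_h * jc_n I ^ (z - y - 1)))%:R <= d * #|jc_E I|%:R).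

Let N : R := #|jc_E I|%:R.
Let m : R := (wt s)%:R.
Let z0 : (0 < z)%N. Proof. exact: leq_ltn_trans yz. Qed.
Let t0 : (0 < gap_t)%N. Proof. by rewrite /gap_t addn1. Qed.
Let zt : (z <= gap_t)%N. Proof. by apply: leq_trans (leq_addr _ _); exact: leq_addl. Qed.
Let N_gt0 : 0 < N. Proof. by rewrite ltr0n ltnW. Qed.

(** Logarithms of [N <= 2^m <= 2 z N]; [logE] absorbs the constant [2 z] into [d * ln N]. *)
Lemma wt_ln : ln N <= m * ln 2 /\ m * ln 2 <= (1 + d) * ln N.
Proof.
have /andP[h1 h2] := wt_bounds validI enumI z0.
have e : ln ((2 ^ wt s)%N%:R : R) = m * ln 2 by rewrite natrX lnXn // mulr_natl.
have z2 : 0 < (2 * z)%:R :> R by rewrite ltr0n muln_gt0.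
split; rewrite -e.
  rewrite ler_ln ?posrE //; last by rewrite ltr0n expn_gt0.
  rewrite /N ler_nat; apply: leq_trans (ltnW h1).
  by rewrite leq_pmull.
apply: le_trans (_ : ln ((2 * z)%:R * N) <= _).
  have -> : (2 * z)%:R * N = (2 * (z * #|jc_E I|))%N%:R by rewrite /N !natrM mulrA.
  have NN : (0 < 2 * (z * #|jc_E I|))%N by rewrite !muln_gt0 z0 (ltnW E2).
  by rewrite ler_ln ?ler_nat // posrE ltr0n ?expn_gt0.
by rewrite lnM ?posrE // mulrDl mul1r addrC lerD2l.
Qed.

Lemma gap_valid : km_valid gap_dim (image s gap_t).
Proof.
have [h1 h2] := wt_ln; have [_ _ k0] := validI; have l0 := ln2_gt0.
split=> //; rewrite (card_image validI enumI t0 zt z0) // -/N.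
rewrite /= /dimI natrM -/m /gap_dim -mulrA -mulrA ler_wpM2l ?ler0n //.
by rewrite mulrA mulrAC ler_pdivlMr.
Qed.

Lemma gap_unit G : 0 <= G -> km_unit gap_rho (image s gap_t) * G
  <= N * m ^+ 2 * (G * (w ^+ 2 * (1 + d) ^+ 2)).
Proof.
move=> G0; rewrite /km_unit (card_image validI enumI t0 zt z0) -/N /gap_rho.
have [h1 _] := wt_ln; have l0 := ln2_gt0.
have lN : 0 <= ln N by apply: ln_ge0; rewrite /N -[1]/(1%:R) ler_nat ltnW.
have h : ln N ^+ 2 <= m ^+ 2 * ln 2 ^+ 2 by rewrite -exprMn lerXn2r ?nnegrE // (le_trans lN).
have W0 : 0 <= w ^+ 2 * (1 + d) ^+ 2 by rewrite mulr_ge0 // sqr_ge0.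
rewrite [X in X * G](_ : _ = N * (w ^+ 2 * (1 + d) ^+ 2) * (ln N ^+ 2 / ln 2 ^+ 2)); last by ring.
have : ln N ^+ 2 / ln 2 ^+ 2 <= m ^+ 2 by rewrite ler_pdivrMr ?exprn_gt0.
move=> h3; rewrite [leRHS](_ : _ = N * (w ^+ 2 * (1 + d) ^+ 2) * m ^+ 2 * G); last by ring.
by rewrite ler_wpM2r // ler_wpM2l // mulr_ge0 // ltW.
Qed.

Lemma gap_complete : jc_complete y I -> km_complete gap_rho (image s gap_t).
Proof.
move=> hc; have [c [sigma [h1 h2]]] := image_complete validI enumI t0 zt z0 yz hc.
exists c, sigma; split=> //.
apply: le_trans (_ : (#|jc_E I| * ((z - y) * wt s) ^ 2)%N%:R <= _); first by rewrite ler_nat.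
rewrite natrM natrX natrM -/N -/w -/m /km_unit (card_image validI enumI t0 zt z0) -/N /gap_rho.
have [_ h] := wt_ln; have l0 := ln2_gt0.
have m0 : 0 <= m by rewrite ler0n.
have h' : m ^+ 2 <= ((1 + d) * ln N / ln 2) ^+ 2.
  have hm : m <= (1 + d) * ln N / ln 2 by rewrite ler_pdivlMr.
  by rewrite lerXn2r ?nnegrE // (le_trans m0).
rewrite [leRHS](_ : _ = N * (w ^+ 2 * ((1 + d) * ln N / ln 2) ^+ 2)); last first.
  by field; lra.
by rewrite exprMn ler_wpM2l ?ler0n // ler_wpM2l ?sqr_ge0.
Qed.

Lemma gap_sound : jc_sound alpha y I -> km_sound gap_rho gap_factor (image s gap_t).
Proof.
move=> hs c sigma asg.
(* For large [eps] the factor may be negative, and then the bound is trivial. *)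
have [G0|G0] := leP 0 gap_factor; last first.
  apply: le_trans (_ : 0 <= _); last by rewrite ler0n.
  apply: mulr_le0_ge0; first exact: ltW.
  have rho0 := ltW gap_rho_gt0.
  by rewrite /km_unit; apply: mulr_ge0; [apply: mulr_ge0|exact: sqr_ge0].
rewrite mulrC; apply: le_trans (gap_unit G0) _.
have [hh hsl] := code_params z0 r0 wtr.
have [S [B [cS cB hT]]] := image_sound validI enumI t0 z0 y0 yz hh asg.
rewrite (image_cost validI enumI t0 zt z0).
apply: le_trans (_ : N * m ^+ 2 * ((1 - d) * (w - d) ^+ 2 + (1 - alpha - d) * (2 * (w - d) + 1)) <= _).
  rewrite ler_wpM2l ?mulr_ge0 ?sqr_ge0 ?ler0n //.
  exact: gap_constant w_ge1 a0 a1 d0 d1 deps G0.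
apply: (sum_sqr_ge (B := B) (C := jc_covered S)) => //; first exact: ltW.
- exact: w_ge1.

- by apply: le_trans few; rewrite ler_nat.
- exact: hs.
(* The slack is at most [2 z m / r], and [r] was chosen with [2 z <= d r]. *)
have sl : (2 * z ^ 2 * ovI s gap_t + z * (wt s %/ r))%N%:R <= d * m.
  have rp : 0 < r%:R :> R by rewrite ltr0n.
  rewrite -(ler_pM2l rp); apply: le_trans (_ : (2 * z * wt s)%N%:R <= _).
    by rewrite -natrM ler_nat.
  rewrite natrM mulrA [r%:R * d]mulrC ler_wpM2r ?ler0n // natrM.
  exact: dr.
have key (a x : nat) : (a * wt s <= x + (2 * z ^ 2 * ovI s gap_t + z * (wt s %/ r)))%N ->
    (a%:R - d) * m <= x%:R.
  rewrite -(ler_nat R) natrM natrD -/m => h; rewrite mulrBl lerBlDr.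
  by apply: le_trans h _; rewrite lerD2l.
move=> T /hT /= [h1 h2]; split; first exact: key.
case: h2 => [?|h2]; [by left|right].
have -> : w + 1 = (z - y + 1)%N%:R by rewrite natrD.
exact: key.
Qed.

End Instance.
End Gap.

(** * Assembling the theorem *)

Lemma divergent_ge (R : realType) (g : nat -> R) (G : R) :
  (g n @[n --> \oo] --> +oo)%classic -> exists n0, forall n, (n0 < n)%N -> G <= g n.
Proof.
move/cvgryPge => /(_ G) [n0 _ h]; exists n0 => n hn.
by apply: h; apply: ltnW.
Qed.

Lemma km_valid_le (R : realType) (D D' : R) I : D <= D' -> km_valid D I -> km_valid D' I.
Proof.
move=> le [h1 h2 h3]; split=> //; apply: le_trans h3 _.
by apply: ler_wpM2r le; apply: ln_ge0; rewrite -[1]/(1%:R) ler_nat ltnW.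
Qed.

Lemma two_points_valid (R : realType) (D : R) d k : (0 < d)%N -> (0 < k)%N ->
  d%:R <= D * ln (2 : R) -> km_valid D (two_points d k).
Proof. by move=> d0 k0 hD; split=> //; rewrite card_two_points. Qed.

Lemma two_points_yes (R : realType) (rho : R) d : (0 < d)%N -> 0 <= rho ->
  km_complete rho (two_points d 2).
Proof.
move=> d0 rho0; exists (fun i => [tuple of nseq d (i != ord0)]), id; split.
  by move=> _ /imsetP[b _ ->]; exists (if b then ord_max else ord0); case: b.
rewrite two_points_cost // !hamming_id; apply: mulr_ge0; last exact: sqr_ge0.
by apply: mulr_ge0; rewrite ?ler0n.
Qed.

Lemma two_points_no (R : realType) (rho G : R) d : (0 < d)%N ->
  4 * (G * rho * ln (2 : R) ^+ 2) <= d%:R -> km_sound rho G (two_points d 1).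
Proof.
move=> d0 hd c sigma asg; have h := two_points_sound d0 asg.
have h' : (d ^ 2)%N%:R <= (2 * @km_cost (two_points d 1) sigma)%N%:R :> R by rewrite ler_nat.
have d2 : d%:R <= (d ^ 2)%N%:R :> R by rewrite ler_nat -mulnn leq_pmulr.
rewrite natrM in h'; rewrite /km_unit card_two_points //; lra.
Qed.

Theorem theorem3p21 (R : realType) (z y : nat) (alpha : R)
    (hy : (1 <= y)%N) (hyz : (y < z)%N) (halpha : 0 <= alpha < 1)
    (hard : JohnsonCoverageStar_NP_hard alpha z y)
    (eps : R) (heps : 0 < eps) :
  exists rho D : R, 0 < rho /\
    NP_hard (GapKMeans D rho
      (1 + (1 - alpha) * (2 * (z - y)%:R + 1) / (z - y)%:R ^+ 2 - eps)).
Proof.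
have [a0 a1] := andP halpha; have [g [gl hard']] := hard.
have l0 := @ln2_gt0 R.
have [d [d0 d1 deps]] : exists d : R, [/\ 0 < d, d <= 1 / 2 & 20 * d <= eps].
  exists (Num.min (1 / 2) (eps / 20)); split.
  - by rewrite lt_min; apply/andP; split; lra.
  - by rewrite ge_min lexx.
  have : Num.min (1 / 2) (eps / 20) <= eps / 20 by rewrite ge_min lexx orbT.
  lra.
have [r r0 dr] : exists2 r : nat, (0 < r)%N & 2 * z%:R <= d * r%:R.
  have /archi_boundP h : 0 <= 2 * z%:R / d by rewrite divr_ge0 ?mulr_ge0 ?ler0n ?ltW.
  exists (Num.bound (2 * z%:R / d)).+1 => //.
  rewrite [d * _]mulrC -ler_pdivrMr //; apply: le_trans (ltW h) _.
  by rewrite ler_nat.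
pose G := gap_factor z y alpha eps; pose rho := gap_rho z y d.
(* The dimension of the two fixed instances, large enough for a single center to violate the
   soundness threshold for [n = 2]. *)
have [e e0 he] : exists2 e : nat, (0 < e)%N & 4 * (G * rho * ln (2 : R) ^+ 2) <= e%:R.
  have /archi_boundP h := normr_ge0 (4 * (G * rho * ln (2 : R) ^+ 2)).
  exists (Num.bound `|4 * (G * rho * ln (2 : R) ^+ 2)|).+1 => //.
  by apply: le_trans (ler_norm _) _; apply: le_trans (ltW h) _; rewrite ler_nat.
have rho0 : 0 < rho by exact: gap_rho_gt0.
(* One constant for both the images and the fixed instances, which have two points and dimension
   [e]. *)
pose D := gap_dim z r d + e%:R / ln (2 : R).
have dim0 : 0 <= gap_dim z r d.
  by rewrite /gap_dim divr_ge0 ?mulr_ge0 ?ler0n ?ltW // addr_gt0.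
have De : e%:R <= D * ln (2 : R).
  have -> : D * ln (2 : R) = gap_dim z r d * ln (2 : R) + e%:R.
    by rewrite /D mulrDl; congr (_ + _); rewrite divfK ?gt_eqF.
  by rewrite lerDr mulr_ge0 // ltW.
(* [ln N >= x0] yields [logE] from the first summand and [2 * r <= wt s] from the second. *)
pose x0 : R := ln ((2 * z)%:R : R) / d + (2 * r)%N%:R * ln (2 : R).
(* In the density condition, [2 ^ h / d] keeps the exceptional sets of all centers below [d * N],
   while [expR x0 + 2] forces [N > 1] and [ln N >= x0]. *)
have [n0 hn0] := divergent_ge (2 ^+ gap_h z r / d + (expR x0 + 2)) gl.
exists rho, D; split=> //.
apply: (hard_transfer (t := gap_t z r) (n0 := n0) (Q := GapKMeans D rho _)
  (yes_out := ([:: nseq e false; nseq e true], nbits 2))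
  (no_out := ([:: nseq e false; nseq e true], nbits 1)) hyz a1 hard').
- exists (two_points e 2); split; first exact: two_points_encodes.
  by split; [exact: two_points_valid|exact: two_points_yes (ltW rho0)].
- exists (two_points e 1); split; first exact: two_points_encodes.
  by split; [exact: two_points_valid|exact: two_points_no].
move=> I s big dense vI ps; exists (image s (gap_t z r)).
have z0 : (0 < z)%N by exact: leq_ltn_trans hyz.
have t0 : (0 < gap_t z r)%N by rewrite /gap_t addn1.
have zt : (z <= gap_t z r)%N by apply: leq_trans (leq_addr _ _); exact: leq_addl.
have [_ E0 k0] := vI.
set N : R := #|jc_E I|%:R.
pose A : R := (jc_k I * jc_n I ^ (z - y - 1))%N%:R.
have A1 : 1 <= A.
  rewrite /A -[1]/(1%:R) ler_nat muln_gt0 k0 expn_gt0.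
  by rewrite (leq_ltn_trans _ big).
have NA : (2 ^+ gap_h z r / d + (expR x0 + 2)) * A <= N.
  move: dense; rewrite /jc_dense -natrX -natrM -/A -/N; apply: le_trans.
  by apply: ler_wpM2r; [exact: le_trans A1|exact: hn0].
have p0 : 0 <= 2 ^+ gap_h z r / d :> R by rewrite divr_ge0 ?exprn_ge0 ?ltW.
have q0 : 0 < expR x0 := expR_gt0 x0.
have N1 : expR x0 + 2 <= N.
  apply: le_trans NA; rewrite -[leLHS]mulr1; apply: ler_pM => //; lra.
have N0 : 0 < N by lra.
have lN : x0 <= ln N by rewrite -(expRK x0) ler_ln ?posrE //; lra.
have E2 : (1 < #|jc_E I|)%N by rewrite -(ltr_nat R) -/N; lra.
have lz : 0 <= ln ((2 * z)%:R : R).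
  by apply: ln_ge0; rewrite -[1]/(1%:R) ler_nat muln_gt0.
have logE : ln ((2 * z)%:R : R) <= d * ln N.
  rewrite [d * _]mulrC -ler_pdivrMr //; apply: le_trans lN; rewrite /x0 lerDl.
  by rewrite mulr_ge0 ?ler0n // ltW.
have wtr : (2 * r <= wt s)%N.
  have [h _] := wt_ln hyz vI ps E2 logE.
  rewrite -(ler_nat R) -(ler_pM2r l0); apply: le_trans h; apply: le_trans lN.
  by rewrite /x0 lerDr divr_ge0 // ltW.
have few : (jc_k I * (2 ^ gap_h z r * jc_n I ^ (z - y - 1)))%N%:R <= d * N.
  have h : 2 ^+ gap_h z r / d * A <= N.
    by apply: le_trans NA; rewrite mulrDl lerDl mulr_ge0 //; lra.
  rewrite mulnCA natrM -/A natrX.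
  have -> : 2 ^+ gap_h z r * A = d * (2 ^+ gap_h z r / d * A) by field; rewrite gt_eqF.
  by apply: ler_wpM2l h; exact: ltW.
split.
- exact: image_encodes vI ps t0 zt z0.
- move=> cI; split; last exact: gap_complete.
  by apply: km_valid_le (gap_valid r hyz vI ps E2 logE); rewrite lerDl divr_ge0 ?ler0n // ltW.
move=> sI; split; last exact: gap_sound.
by apply: km_valid_le (gap_valid r hyz vI ps E2 logE); rewrite lerDl divr_ge0 ?ler0n // ltW.
Qed.
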